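(* Let $\mathbb K$ and $\mathbb F$ be real closed fields with $\mathbb K\subseteq \mathbb R\cap\mathbb F$, and let $\mathbf G$ be a semisimple self-adjoint linear algebraic group defined over $\mathbb K$. Then any maximal $\mathbb K$-split torus $\mathbf S<\mathbf G$ is maximal $\mathbb F$-split. Moreover, there is a maximal $\mathbb F$-split torus $\mathbf S$ of $\mathbf G$ such that $g^{\mathsf T}=g$ for all $g\in\mathbf S$.
   Context: Let $\mathbb D$ be an algebraically closed field containing $\mathbb R$ and $\mathbb F$. A linear algebraic group is a Zariski-closed subgroup of some $\mathrm{GL}_n(\mathbb D)$; it is defined over a subfield $k\subseteq\mathbb D$ if it is the set of common zeros of polynomials in $k[(x_{ij}),\det(x_{ij})^{-1}]$. It is semisimple if it is Zariski-connected and every closed connected normal abelian subgroup is trivial. It is self-adjoint if $g\in\mathbf G$ implies $g^{\mathsf T}\in\mathbf G$. A torus is an algebraic group isomorphic to $(\mathbf G_m)^d$ for some $d$, where $\mathbf G_m=\mathrm{GL}_1(\mathbb D)$. A torus is $k$-split if it is defined over $k$ and there is an isomorphism to $(\mathbf G_m)^d$ defined over $k$. A maximal $k$-split torus of $\mathbf G$ is a $k$-split torus in $\mathbf G$ that is maximal, with respect to inclusion, among the $k$-split tori of $\mathbf G$. *)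

(* Defs.v *)
From HB Require Import structures.
From mathcomp Require Import all_boot all_order all_algebra.
From mathcomp Require Import classical_sets reals.
From mathcomp Require Import mpoly.

Set Implicit Arguments.
Unset Strict Implicit.
Unset Printing Implicit Defensive.

Import GRing.Theory.
Local Open Scope ring_scope.
Local Open Scope classical_set_scope.

(* A subfield of D is represented by a field k with an embedding
   iota : {rmorphism k -> D}; the field D itself corresponds to idfun. *)

(* The values at g of the generators x_ij and det(x_ij)^-1 of
   k[(x_ij), det(x_ij)^-1]. *)
Definition gl_coords (D : closedFieldType) (n : nat) (g : 'M[D]_n) :
    'I_(n * n + 1) -> D :=
  row_mx (mxvec g) (const_mx (\det g)^-1) 0.

Definition eval_over (D : closedFieldType) (k : fieldType)
    (iota : {rmorphism k -> D}) (n : nat)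
    (p : {mpoly k[n * n + 1]}) (g : 'M[D]_n) : D :=
  (map_mpoly iota p).@[gl_coords g].

Definition defined_over (D : closedFieldType) (k : fieldType)
    (iota : {rmorphism k -> D}) (n : nat) (A : set 'M[D]_n) : Prop :=
  exists E : set {mpoly k[n * n + 1]},
    A = [set g | g \in unitmx /\ forall p, E p -> eval_over iota p g = 0].

Definition zariski_closed (D : closedFieldType) (n : nat)
    (A : set 'M[D]_n) : Prop :=
  defined_over (idfun : {rmorphism D -> D}) A.

Definition zariski_connected (D : closedFieldType) (n : nat)
    (A : set 'M[D]_n) : Prop :=
  A !=set0 /\
  forall B C : set 'M[D]_n, zariski_closed B -> zariski_closed C ->
    A `<=` B `|` C -> A `&` B `&` C = set0 ->
    A `&` B = set0 \/ A `&` C = set0.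

Definition linear_algebraic_group (D : closedFieldType) (n : nat)
    (G : set 'M[D]_n) : Prop :=
  [/\ zariski_closed G,
      G 1%:M,
      (forall g h, G g -> G h -> G (g *m h)) &
      (forall g, G g -> G (invmx g))].

Definition semisimple (D : closedFieldType) (n : nat)
    (G : set 'M[D]_n) : Prop :=
  zariski_connected G /\
  forall N : set 'M[D]_n,
    linear_algebraic_group N -> N `<=` G -> zariski_connected N ->
    (forall g h, G g -> N h -> N (g *m h *m invmx g)) ->
    (forall g h, N g -> N h -> g *m h = h *m g) ->
    N = [set 1%:M].

Definition self_adjoint (D : closedFieldType) (n : nat)
    (G : set 'M[D]_n) : Prop :=
  forall g, G g -> G g^T.

(* Only the values of f on A are relevant. *)
Definition morphism_over (D : closedFieldType) (k : fieldType)
    (iota : {rmorphism k -> D}) (n m : nat)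
    (A : set 'M[D]_n) (B : set 'M[D]_m) (f : 'M[D]_n -> 'M[D]_m) : Prop :=
  [/\ (exists P : 'I_m -> 'I_m -> {mpoly k[n * n + 1]},
         forall g, A g -> f g = \matrix_(i, j) eval_over iota (P i j) g),
      (forall g, A g -> B (f g)) &
      (forall g h, A g -> A h -> f (g *m h) = f g *m f h)].

Definition isomorphic_over (D : closedFieldType) (k : fieldType)
    (iota : {rmorphism k -> D}) (n m : nat)
    (A : set 'M[D]_n) (B : set 'M[D]_m) : Prop :=
  exists (f : 'M[D]_n -> 'M[D]_m) (f' : 'M[D]_m -> 'M[D]_n),
    [/\ morphism_over iota A B f,
        morphism_over iota B A f',
        (forall g, A g -> f' (f g) = g) &
        (forall h, B h -> f (f' h) = h)].

(* (G_m)^d, realised as the group of diagonal matrices in GL_d(D). *)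
Definition Gm_pow (D : closedFieldType) (d : nat) : set 'M[D]_d :=
  [set diag_mx v | v in [set v : 'rV[D]_d | forall i, v 0 i != 0]].

Arguments Gm_pow D d : clear implicits.

Definition torus (D : closedFieldType) (n : nat) (T : set 'M[D]_n) : Prop :=
  linear_algebraic_group T /\
  exists d : nat,
    isomorphic_over (idfun : {rmorphism D -> D}) T (Gm_pow D d).

Definition split_torus (D : closedFieldType) (k : fieldType)
    (iota : {rmorphism k -> D}) (n : nat) (T : set 'M[D]_n) : Prop :=
  [/\ torus T,
      defined_over iota T &
      exists d : nat, isomorphic_over iota T (Gm_pow D d)].

Definition maximal_split_torus (D : closedFieldType) (k : fieldType)
    (iota : {rmorphism k -> D}) (n : nat) (G S : set 'M[D]_n) : Prop :=
  [/\ split_torus iota S,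
      S `<=` G &
      forall T : set 'M[D]_n,
        split_torus iota T -> T `<=` G -> S `<=` T -> T = S].

(* Main.v *)
Require Import Defs.
From HB Require Import structures.
From mathcomp Require Import all_boot all_order all_algebra.
From mathcomp Require Import fingroup perm complex ring lra.
From mathcomp Require boolp classical_sets reals topology normedtype derive.
From mathcomp Require mpoly qe_rcf_th ordered_qelim qe_rcf.

(** A torus split over a subfield [k] of [D] is diagonal in a basis rational
    over [k]: it is the set of all [h *m diag(y^a_1, ..., y^a_n) *m h^-1], where
    [h] is invertible over [k] and the exponents [a_j] are integer vectors that
    generate Z^e ([split_torusP], [split_torus_of]).  The coordinate functions of
    an isomorphism with G_m^e are Laurent polynomials, and Dedekind's
    independence of the characters [y^b] ([mon_free]) turns the homomorphism
    property into identities between their coefficient matrices, which are then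
    orthogonal idempotents over [k], hence diagonalizable simultaneously.

    For fixed exponents, the condition that such a torus lies in [G] is a
    family of polynomial equations over [K] in the entries of [h] and of its
    inverse, because it suffices to test the points [y] with coordinates in
    the infinite field [K] ([laurent_dense]).  A family of polynomial equations
    over a real closed field [K] that has a solution in a larger real closed
    field has a solution in [K] ([transfer_zero]): by the basis theorem of
    Hilbert ([mpoly_noetherian]) the family is equivalent to a finite one, hence
    to a single equation by taking a sum of squares, and the quantifier
    elimination of Tarski commutes with the embedding ([transfer_formula]).

    First assertion.  Let [S] be maximal [K]-split and let [T] be an [F]-split
    torus of [G] that contains it.  The inclusion is given by an integer
    matrix [M] ([torus_of_sub]), so that [S] is contained in [T] is again a family
    of equations over [K] in [h].  Transfer gives a [K]-split torus of [G] that
    contains [S] through the same matrix [M].  By maximality it is equal to [S],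
    hence [M] induces a surjection on points, and then [S] is all of [T]
    ([maximal_split_torus_extends]).

    Second assertion.  Take an [F]-split torus of [G] of maximal dimension [e].
    Transfer brings it down to [K], and then up to [R].  Over the real numbers,
    consider all tori in [G] with the same exponents, and represent each of
    them by its value [g] at one point [t] whose monomials [t^a_j] separate the
    exponents.  The matrices [g] that arise in this way form a real algebraic
    set, so there is one of least Euclidean norm ([exists_min_sqnorm]).  Let [s]
    be the square root of [g^T *m g], and [b] that of [s]; both are in [G], since
    [G] is self-adjoint and a positive definite element of an algebraic group
    has its square root in the group ([gl_zeros_sqrt]).  The conjugate
    [b *m g *m b^-1], which is the Aluthge transform of [g], has norm at most that
    of [g], with equality only if [g] is normal ([aluthge_trace]).  A minimal
    [g] is therefore normal, and, having real eigenvalues, symmetric; then so is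
    its whole torus ([symmetric_torus]).  The symmetry of a torus is
    one more family of polynomial equations, so transfer gives a symmetric torus
    over [K] with the same exponents.  It has dimension [e], hence is maximal
    [F]-split: an inclusion between split tori of equal dimension is an
    equality ([torus_of_eq]). *)

Set Implicit Arguments.
Unset Strict Implicit.
Unset Printing Implicit Defensive.

(** * Points of least norm on real algebraic sets *)

Module MinimalVector.
Import boolp classical_sets reals topology normedtype derive.
Import Order.TTheory GRing.Theory Num.Theory.
Import numFieldNormedType.Exports.
Local Open Scope classical_set_scope.
Local Open Scope ring_scope.

Section Minimum.
Variables (R : realType) (N : nat).
Implicit Types (f g : 'rV[R]_N -> R) (v w : 'rV[R]_N).

Lemma continuous_sum (I : Type) (s : seq I) (F : I -> 'rV[R]_N -> R) :
  (forall l, continuous (F l)) -> continuous (fun v => \sum_(l <- s) F l v).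
Proof.
move=> Fc; elim: s => [|l s IHs].
  under eq_fun => v do rewrite big_nil.
  exact: cst_continuous.
under eq_fun => v do rewrite big_cons.
by move=> v; apply: continuousD; [exact: Fc | exact: IHs].
Qed.

Lemma continuous_prod (I : Type) (s : seq I) (F : I -> 'rV[R]_N -> R) :
  (forall l, continuous (F l)) -> continuous (fun v => \prod_(l <- s) F l v).
Proof.
move=> Fc; elim: s => [|l s IHs].
  under eq_fun => v do rewrite big_nil.
  exact: cst_continuous.
under eq_fun => v do rewrite big_cons.
by move=> v; apply: continuousM; [exact: Fc | exact: IHs].
Qed.

Lemma continuous_exp f m : continuous f -> continuous (fun v => f v ^+ m).
Proof.
move=> fc; elim: m => [|m IHm].
  under eq_fun => v do rewrite expr0.
  exact: cst_continuous.
under eq_fun => v do rewrite exprS.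
by move=> v; exact: (continuousM (fc v) (IHm v)).
Qed.

Lemma continuous_coord l : continuous (fun v : 'rV[R]_N => v 0 l).
Proof. exact: coord_continuous. Qed.

Lemma meval_continuous (q : mpoly.mpoly N R) :
  continuous (fun v : 'rV[R]_N => mpoly.meval (fun l => v 0 l) q).
Proof.
under eq_fun => v do rewrite mpoly.mevalE.
apply: continuous_sum => m v; apply: continuousM; first exact: cst_continuous.
apply: continuous_prod => l; apply: continuous_exp; exact: continuous_coord.
Qed.

Definition sqnorm v : R := \sum_l v 0 l ^+ 2.

Lemma sqnorm_continuous : continuous sqnorm.
Proof.
by apply: continuous_sum => l; apply: continuous_exp; exact: continuous_coord.
Qed.

(** The zeros of norm at most that of a given zero form a closed and bounded set,
    so that the norm attains its minimum on it. *)
Lemma exists_min_sqnorm (Q : mpoly.mpoly N R -> Prop)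
    (Z := fun v : 'rV[R]_N => forall q, Q q -> mpoly.meval (fun l => v 0 l) q = 0) :
  (exists v, Z v) -> exists2 v, Z v & forall w, Z w -> sqnorm v <= sqnorm w.
Proof.
move=> [v0 Zv0]; pose A := [set v | Z v /\ sqnorm v <= sqnorm v0].
have le_coord v l : v 0 l ^+ 2 <= sqnorm v.
  rewrite /sqnorm (bigD1 l) //= lerDl sumr_ge0 // => j _; exact: sqr_ge0.
have Acl : closed A.
  have -> : A = (\bigcap_(q in Q)
      ((fun v : 'rV[R]_N => mpoly.meval (fun l => v 0 l) q) @^-1` [set 0]))
      `&` (sqnorm @^-1` [set x | x <= sqnorm v0]) by [].
  apply: closedI.
    apply: closed_bigI => q _.
    by apply: closed_comp => [v _|]; [apply: meval_continuous | apply: closed_eq].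
  by apply: closed_comp => [v _|]; [apply: sqnorm_continuous | apply: closed_le].
have Acp : compact A.
  pose C := 1 + sqnorm v0.
  have box : compact [set v : 'rV[R]_N | forall l, v ord0 l \in `[(- C), C]].
    apply: (@rV_compact _ _ (fun=> `[(- C), C]%classic)) => _.
    exact: segment_compact.
  apply: subclosed_compact Acl box _ => v [_ le_v] l.
  have C1 : 1 <= C by rewrite lerDl sumr_ge0 // => j _; apply: sqr_ge0.
  rewrite in_itv /= -ler_norml; have [le_v1|gt_v1] := leP `|v ord0 l| 1.
    exact: le_trans C1.
  apply: (@le_trans _ _ (`|v ord0 l| ^+ 2)).
    by rewrite expr2 ler_peMl // ltW.
  rewrite real_normK ?num_real //; apply: le_trans (le_coord v l) _.
  by apply: le_trans le_v _; rewrite lerDr.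
have A0 : A !=set0 by exists v0.
have [v Av minv] := EVT_min_rV A0 Acp
  (continuous_subspaceT sqnorm_continuous).
move: Av; rewrite inE => -[Zv le_v]; exists v => // w Zw.
have [le_w|lt_w] := leP (sqnorm w) (sqnorm v0); first by apply: minv; rewrite inE.
exact: le_trans le_v (ltW lt_w).
Qed.

End Minimum.
End MinimalVector.

From mathcomp Require Import boolp classical_sets reals.
From mathcomp Require Import mpoly.

Import Order.TTheory GRing.Theory Num.Theory.
Local Open Scope ring_scope.

(** * Evaluation of polynomials along ring morphisms *)

Section MevalMap.
Variable N : nat.
Implicit Types A B C : comNzRingType.

Lemma meval_mapE A B (f : {rmorphism A -> B}) (p : {mpoly A[N]}) (v : 'I_N -> B) :
  (map_mpoly f p).@[v] = \sum_(m <- msupp p) f p@_m * \prod_j v j ^+ m j.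
Proof.
rewrite [p in LHS]mpolyE; elim: (msupp p) => [|m s IHs].
  by rewrite !big_nil !raddf0.
by rewrite !big_cons !raddfD /= IHs map_mpolyZ map_mpolyX mevalZ mevalX.
Qed.

Lemma rmorph_meval_map A B C (f : {rmorphism A -> B}) (g : {rmorphism B -> C})
    (p : {mpoly A[N]}) (v : 'I_N -> B) :
  g (map_mpoly f p).@[v] = (map_mpoly (g \o f) p).@[fun j => g (v j)].
Proof.
rewrite !meval_mapE rmorph_sum; apply: eq_bigr => m _ /=.
by rewrite rmorphM rmorph_prod; congr (_ * _); apply: eq_bigr => j _; rewrite rmorphXn.
Qed.

Lemma eq_meval_map A B (f f' : {rmorphism A -> B}) (p : {mpoly A[N]})
    (v v' : 'I_N -> B) : f =1 f' -> v =1 v' ->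
  (map_mpoly f p).@[v] = (map_mpoly f' p).@[v'].
Proof.
move=> ff vv; rewrite !meval_mapE; apply: eq_bigr => m _; rewrite ff.
by congr (_ * _); apply: eq_bigr => j _; rewrite vv.
Qed.

Lemma meval_map_id A (f : {rmorphism A -> A}) (p : {mpoly A[N]}) (v : 'I_N -> A) :
  f =1 id -> (map_mpoly f p).@[v] = p.@[v].
Proof.
move=> f_id; rewrite meval_mapE mevalE; apply: eq_bigr => m _.
by rewrite f_id.
Qed.

End MevalMap.

(** * Quantifier elimination commutes with embeddings of real closed fields *)

Module QElim.
Import qe_rcf_th ordered_qelim qe_rcf.

Section Naturality.
Variables (K F : rcfType) (i : {rmorphism K -> F}).

Fixpoint map_term (t : qe_rcf.term K) : qe_rcf.term F :=
  match t with
  | Var x => Var F x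
  | Const c => Const (i c)
  | NatConst m => NatConst F m
  | Add u v => Add (map_term u) (map_term v)
  | Opp u => Opp (map_term u)
  | NatMul u m => NatMul (map_term u) m
  | Mul u v => Mul (map_term u) (map_term v)
  | Exp u m => Exp (map_term u) m
  end.

Fixpoint map_qff (f : qe_rcf.formula K) : qe_rcf.formula F :=
  match f with
  | Bool b => Bool b
  | Equal u v => Equal (map_term u) (map_term v)
  | Lt u v => Lt (map_term u) (map_term v)
  | Le u v => Le (map_term u) (map_term v)
  | And f g => And (map_qff f) (map_qff g)
  | Or f g => Or (map_qff f) (map_qff g)
  | Implies f g => Implies (map_qff f) (map_qff g)
  | Not f => Not (map_qff f)
  end.

Local Notation mp := (map map_term).

(** The elimination procedure is written in continuation-passing style: a test
    on a coefficient becomes a formula that calls the continuation in each of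
    the possible cases.  [natural h c c'] expresses that such a program
    commutes with the embedding, [h] being the effect of the embedding on
    the intermediate result that is passed on. *)
Definition natural T T' (h : T -> T') (c : (T -> qe_rcf.formula K) -> qe_rcf.formula K)
    (c' : (T' -> qe_rcf.formula F) -> qe_rcf.formula F) :=
  forall k k', (forall x, map_qff (k x) = k' (h x)) -> map_qff (c k) = c' k'.

Lemma nat_Size p : natural id (Size p) (Size (mp p)).
Proof.
elim: p => [|a p IHp] k k' kE /=; first exact: kE.
apply: IHp => -[|m] /=; last exact: kE.
by rewrite !kE.
Qed.

Lemma nat_Isnull p : natural id (Isnull p) (Isnull (mp p)).
Proof. by move=> k k' kE; apply: nat_Size => m; apply: kE. Qed.

Lemma nat_LtSize p q : natural id (LtSize p q) (LtSize (mp p) (mp q)).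
Proof.
by move=> k k' kE; apply: nat_Size => m; apply: nat_Size => m'; apply: kE.
Qed.

Lemma nat_LeadCoef p : natural map_term (LeadCoef p) (LeadCoef (mp p)).
Proof.
elim: p => [|a p IHp] k k' kE /=; first by rewrite kE /= rmorph0.
by apply: IHp => l /=; rewrite !kE.
Qed.

Lemma map_AmulXn a m : mp (AmulXn a m) = AmulXn (map_term a) m.
Proof. by elim: m => //= m ->; rewrite rmorph0. Qed.

Lemma map_AddPoly p q : mp (AddPoly p q) = AddPoly (mp p) (mp q).
Proof. by elim: p q => [|a p IHp] [|b q] //=; rewrite IHp. Qed.

Lemma map_ScalPoly c p : mp (ScalPoly c p) = ScalPoly (map_term c) (mp p).
Proof. by rewrite /ScalPoly -!map_comp. Qed.

Lemma map_MulPoly p q : mp (MulPoly p q) = MulPoly (mp p) (mp q).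
Proof. by elim: p => //= a p IHp; rewrite map_AddPoly map_ScalPoly /= IHp. Qed.

Lemma map_ExpPoly p m : mp (ExpPoly p m) = ExpPoly (mp p) m.
Proof.
case: m => [|m] //; rewrite /ExpPoly /iterop.
by elim: m => //= m IHm; rewrite map_MulPoly IHm.
Qed.

Lemma map_OppPoly p : mp (OppPoly p) = OppPoly (mp p).
Proof. by rewrite /OppPoly map_ScalPoly /= rmorphN1. Qed.

Lemma map_NatMulPoly m p : mp (NatMulPoly m p) = NatMulPoly m (mp p).
Proof. exact: map_ScalPoly. Qed.

Lemma map_Deriv p : mp (Deriv p) = Deriv (mp p).
Proof. by elim: p => //= a p IHp; rewrite map_AddPoly /= IHp. Qed.

Definition map_div (d : nat * polyF K * polyF K) : nat * polyF F * polyF F :=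
  (d.1.1, mp d.1.2, mp d.2).

Lemma nat_Rediv_rec_loop q sq cq c qq r m :
  natural map_div (Rediv_rec_loop q sq cq c qq r m)
    (Rediv_rec_loop (mp q) sq (map_term cq) c (mp qq) (mp r) m).
Proof.
elim: m c qq r => [|m IHm] c qq r k k' kE /=.
all: apply: nat_Size => sr; case: ifP => _; first exact: kE.
all: apply: nat_LeadCoef => lr.
  by rewrite kE /map_div /= !map_AddPoly map_OppPoly !map_MulPoly map_AmulXn.
by rewrite (IHm _ _ _ _ k') // !map_AddPoly map_OppPoly !map_MulPoly map_AmulXn.
Qed.

Lemma nat_Rediv p q : natural map_div (Rediv p q) (Rediv (mp p) (mp q)).
Proof.
move=> k k' kE; apply: nat_Isnull => b /=.
case: b; first by rewrite kE /map_div /= rmorph0.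
apply: nat_Size => sq; apply: nat_Size => sp; apply: nat_LeadCoef => lq.
by rewrite (nat_Rediv_rec_loop _ _ _ _ _ _ _ kE) /= rmorph0.
Qed.

Lemma nat_Rmod p q : natural mp (Rmod p q) (Rmod (mp p) (mp q)).
Proof. by move=> k k' kE; apply: nat_Rediv => d; apply: kE. Qed.

Lemma nat_Rscal p q : natural id (Rscal p q) (Rscal (mp p) (mp q)).
Proof. by move=> k k' kE; apply: nat_Rediv => d; apply: kE. Qed.

Lemma nat_Rgcd_loop m p q :
  natural mp (Rgcd_loop m p q) (Rgcd_loop m (mp p) (mp q)).
Proof.
elim: m p q => [|m IHm] p q k k' kE /=; apply: nat_Rmod => r;
  apply: nat_Isnull => -[] //=; try exact: kE.
exact: IHm.
Qed.

Lemma nat_Rgcd p q : natural mp (Rgcd p q) (Rgcd (mp p) (mp q)).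
Proof.
move=> k k' kE; apply: nat_LtSize => -[] /=; apply: nat_Isnull => -[] /=;
  rewrite ?kE //; apply: nat_Size => m; exact: nat_Rgcd_loop.
Qed.

Lemma nat_BigRgcd ps : natural mp (BigRgcd ps) (BigRgcd (map mp ps)).
Proof.
elim: ps => [|p ps IHps] k k' kE /=; first by rewrite kE /= rmorph0.
by apply: IHps => r; apply: nat_Rgcd.
Qed.

Lemma nat_Changes s : natural id (Changes s) (Changes (mp s)).
Proof.
elim: s => [|a s IHs] k k' kE /=; first exact: kE.
apply: IHs => v /=; rewrite !kE; 
  congr (Or (And (Lt (Mul _ _) _) _) (And (Not (Lt (Mul _ _) _)) _)).
all: by case: s.
Qed.

Lemma nat_SeqPInfty ps : natural mp (SeqPInfty ps) (SeqPInfty (map mp ps)).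
Proof.
elim: ps => [|p ps IHps] k k' kE /=; first exact: kE.
by apply: nat_LeadCoef => lp; apply: IHps => lps; apply: kE.
Qed.

Lemma nat_SeqMInfty ps : natural mp (SeqMInfty ps) (SeqMInfty (map mp ps)).
Proof.
elim: ps => [|p ps IHps] k k' kE /=; first exact: kE.
apply: nat_LeadCoef => lp; apply: nat_Size => sp; apply: IHps => lps.
by rewrite kE /= rmorphN1.
Qed.

Lemma nat_ChangesPoly ps :
  natural id (ChangesPoly ps) (ChangesPoly (map mp ps)).
Proof.
move=> k k' kE; apply: nat_SeqMInfty => mps; apply: nat_SeqPInfty => pps.
by apply: nat_Changes => vm; apply: nat_Changes => vp; apply: kE.
Qed.

Lemma nat_NextMod p q : natural mp (NextMod p q) (NextMod (mp p) (mp q)).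
Proof.
move=> k k' kE; apply: nat_LeadCoef => lq; apply: nat_Rscal => spq.
by apply: nat_Rmod => rpq; rewrite kE map_ScalPoly.
Qed.

Lemma nat_ModsAux p q m :
  natural (map mp) (ModsAux p q m) (ModsAux (mp p) (mp q) m).
Proof.
elim: m p q => [|m IHm] p q k k' kE /=; first exact: kE.
apply: nat_Isnull => -[] /=; first exact: kE.
by apply: nat_NextMod => npq; apply: IHm => ps; apply: kE.
Qed.

Lemma nat_Mods p q : natural (map mp) (Mods p q) (Mods (mp p) (mp q)).
Proof.
by move=> k k' kE; apply: nat_Size => sp; apply: nat_Size => sq;
   apply: nat_ModsAux.
Qed.

Lemma map_nth_polys ps m : mp (nth [::] ps m) = nth [::] (map mp ps) m.
Proof. by elim: ps m => [|p ps IHps] [|m] //=. Qed.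

Lemma map_PolyComb ps sc : mp (PolyComb ps sc) = PolyComb (map mp ps) sc.
Proof.
rewrite /PolyComb size_map; elim: (iota _ _) => //= m s IHs.
by rewrite map_MulPoly IHs map_ExpPoly map_nth_polys.
Qed.

Lemma map_Pcq ps m : mp (Pcq ps m) = Pcq (map mp ps) m.
Proof.
rewrite /Pcq map_nth_polys size_map -map_comp; congr (nth _ _ _).
by apply: eq_map => sc /=; rewrite map_PolyComb.
Qed.

Lemma nat_TaqR p q : natural id (TaqR p q) (TaqR (mp p) (mp q)).
Proof.
move=> k k' kE; rewrite /TaqR -map_Deriv -map_MulPoly.
by apply: nat_Mods => r; apply: nat_ChangesPoly.
Qed.

Lemma nat_TaqsR p sq m :
  natural map_term (TaqsR p sq m) (TaqsR (mp p) (map mp sq) m).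
Proof.
move=> k k' kE; rewrite /TaqsR -map_Pcq; apply: nat_TaqR => z.
by rewrite kE /= rmorph_int.
Qed.

Lemma map_BoundingPoly sq :
  mp (BoundingPoly sq) = BoundingPoly (map mp sq).
Proof.
rewrite /BoundingPoly map_Deriv; congr Deriv.
by elim: sq => //= p sq IHsq; rewrite map_MulPoly IHsq.
Qed.

(** These constants are entries of the inverse of an integer matrix, hence
    rational. *)
Lemma rmorph_coefs m j : i (coefs K m j) = coefs F m j.
Proof.
rewrite /coefs; elim: (enum _) j => [|x s IHs] [|j] //=; rewrite ?rmorph0 //.
rewrite !castmxE /=.
have -> : map_mx (intmul 1) (ctmat m) = map_mx i (map_mx (intmul 1) (ctmat m)).
  by apply/matrixP => x1 x2; rewrite !mxE rmorph_int.
by rewrite -map_invmx mxE.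
Qed.

Lemma map_Coefs m j : map_term (Coefs K m j) = Coefs F m j.
Proof.
rewrite /Coefs /=; congr Const; case: m => [|[|m]]; last exact: rmorph_coefs.
  by rewrite rmorph_nat.
by case: j => [|[|[|j]]] /=; rewrite ?fmorphV ?rmorph_nat ?nth_nil ?rmorph0.
Qed.

Lemma nat_CcountWeak p sq :
  natural map_term (CcountWeak p sq) (CcountWeak (mp p) (map mp sq)).
Proof.
move=> k k' kE; rewrite /CcountWeak size_map.
have -> : NatConst F 0 = map_term (NatConst K 0) by [].
elim: (3 ^ size sq)%N (NatConst K 0) => [|m IHm] s /=; first exact: kE.
by apply: nat_TaqsR => x; rewrite IHm -?map_Coefs.
Qed.

Lemma map_CcountGt0 sp sq :
  map_qff (CcountGt0 sp sq) = CcountGt0 (map mp sp) (map mp sq).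
Proof.
apply: nat_BigRgcd => p; apply: nat_Isnull => -[] /=; last first.
  exact: nat_CcountWeak.
rewrite -map_BoundingPoly.
apply: nat_CcountWeak => cw /=; congr (Or _ (Or _ _)).
all: elim: sq => //= q sq ->; congr And.
  by apply: nat_LeadCoef.
by apply: nat_Size => s; apply: nat_LeadCoef.
Qed.

Lemma map_abstrX m t : mp (abstrX m t) = abstrX m (map_term t).
Proof.
elim: t => //=.
- by move=> x; case: ifP.
- by move=> u IHu v IHv; rewrite map_AddPoly IHu IHv.
- by move=> u IHu; rewrite map_OppPoly IHu.
- by move=> u IHu j; rewrite map_NatMulPoly IHu.
- by move=> u IHu v IHv; rewrite map_MulPoly IHu IHv.
- by move=> u IHu j; rewrite map_ExpPoly IHu.
Qed.

Fixpoint map_gterm (t : GRing.term K) : GRing.term F :=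
  match t with
  | GRing.Var x => GRing.Var F x
  | GRing.Const c => GRing.Const (i c)
  | GRing.NatConst m => GRing.NatConst F m
  | GRing.Add u v => GRing.Add (map_gterm u) (map_gterm v)
  | GRing.Opp u => GRing.Opp (map_gterm u)
  | GRing.NatMul u m => GRing.NatMul (map_gterm u) m
  | GRing.Mul u v => GRing.Mul (map_gterm u) (map_gterm v)
  | GRing.Inv u => GRing.Inv (map_gterm u)
  | GRing.Exp u m => GRing.Exp (map_gterm u) m
  end.

Fixpoint map_form (f : ord.formula K) : ord.formula F :=
  match f with
  | ord.Bool b => ord.Bool b
  | ord.Equal u v => ord.Equal (map_gterm u) (map_gterm v)
  | ord.Lt u v => ord.Lt (map_gterm u) (map_gterm v)
  | ord.Le u v => ord.Le (map_gterm u) (map_gterm v)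
  | ord.Unit u => ord.Unit (map_gterm u)
  | ord.And f g => ord.And (map_form f) (map_form g)
  | ord.Or f g => ord.Or (map_form f) (map_form g)
  | ord.Implies f g => ord.Implies (map_form f) (map_form g)
  | ord.Not f => ord.Not (map_form f)
  | ord.Exists m f => ord.Exists m (map_form f)
  | ord.Forall m f => ord.Forall m (map_form f)
  end.

Lemma map_to_rterm t : map_term (to_rterm t) = to_rterm (map_gterm t).
Proof.
by elim: t => //= [u -> v ->|u ->|u -> m|u -> v ->|u -> m].
Qed.

Lemma map_rterm_to_term (t : qe_rcf.term K) :
  map_gterm (rterm_to_term t) = rterm_to_term (map_term t).
Proof. by elim: t => //= [u -> v ->|u ->|u -> m|u -> v ->|u -> m]. Qed.

Lemma map_qfr_to_formula (f : qe_rcf.formula K) :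
  map_form (qfr_to_formula f) = qfr_to_formula (map_qff f).
Proof.
elim: f => //= [u v|u v|u v|f -> g ->|f -> g ->|f -> g ->|f ->] //.
all: by rewrite !map_rterm_to_term.
Qed.

Local Notation mg := (map map_gterm).

Lemma map_wproj m s :
  map_form (wproj m s) = wproj m (mg s.1, mg s.2).
Proof.
rewrite map_qfr_to_formula /wproj map_CcountGt0 /= -!map_comp.
by congr (qfr_to_formula (CcountGt0 _ _)); apply: eq_map => t /=;
   rewrite map_abstrX map_to_rterm.
Qed.

Definition map_clause (c : ord.oclause K) : ord.oclause F :=
  let: ord.Oclause c1 c2 c3 c4 := c in
  ord.Oclause (mg c1) (mg c2) (mg c3) (mg c4).

Local Notation mc := (map map_clause).

Lemma map_and_odnf s t :
  mc (ord.and_odnf s t) = ord.and_odnf (mc s) (mc t).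
Proof.
rewrite /ord.and_odnf; elim: s => [|c s IHs]; first by rewrite !big_nil.
rewrite /= !big_cons map_cat IHs; congr (_ ++ _).
rewrite -!map_comp; apply: eq_map => -[c1 c2 c3 c4] /=.
by case: c => d1 d2 d3 d4 /=; rewrite !map_cat.
Qed.

Lemma map_qf_to_odnf f b :
  mc (ord.qf_to_odnf f b) = ord.qf_to_odnf (map_form f) b.
Proof.
elim: f b => /= [b|u v|u v|u v|u|f IHf g IHg|f IHf g IHg|f IHf g IHg|f IHf|m f IHf|m f IHf] c.
all: try by case: c.
- by case: (b (+) c).
all: case: c => /=; by rewrite ?map_and_odnf ?map_cat IHf IHg.
Qed.

Lemma map_oclause_to_w c :
  [seq (mg s.1, mg s.2) | s <- ord.oclause_to_w c]
  = ord.oclause_to_w (map_clause c).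
Proof.
have lqE c1 c3 c4 : ord.leq_elim_aux (mg c1) (mg c3) (mg c4)
    = [seq (mg s.1, mg s.2) | s <- ord.leq_elim_aux c1 c3 c4].
  elim: c4 => //= t c4 ->; rewrite map_cat -!map_comp.
  by congr (_ ++ _); apply: eq_map.
have leqE d : ord.oclause_leq_elim (map_clause d) = mc (ord.oclause_leq_elim d).
  by case: d => c1 c2 c3 c4 /=; rewrite lqE -!map_comp; apply: eq_map.
have nqE c3 c2 : ord.neq_elim_aux (mg c3) (mg c2)
    = [seq mg s | s <- ord.neq_elim_aux c3 c2].
  elim: c2 => //= t c2 ->; rewrite map_cat -!map_comp.
  by congr (_ ++ _); apply: eq_map.
have neqE d : ord.oclause_neq_elim (map_clause d) = mc (ord.oclause_neq_elim d).
  by case: d => c1 c2 c3 c4 /=; rewrite nqE -!map_comp; apply: eq_map.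
rewrite /ord.oclause_to_w /ord.oclause_neq_leq_elim leqE.
rewrite -[in RHS]map_comp (eq_map neqE) (map_comp mc) -map_flatten.
by rewrite -!map_comp; apply: eq_map => -[c1 c2 c3 c4].
Qed.

(** The procedure combines terms without ever inspecting a constant of the field,
    so it acts in the same way before and after the embedding. *)
Lemma map_quantifier_elim f :
  map_form (ord.quantifier_elim (@wproj K) f)
  = ord.quantifier_elim (@wproj F) (map_form f).
Proof.
have foldrE s : map_form (foldr ord.Or ord.False s)
    = foldr ord.Or ord.False (map map_form s).
  by elim: s => //= g s ->.
have projE m c : map_form (ord.proj (@wproj K) m c)
    = ord.proj (@wproj F) m (map_clause c).
  rewrite /ord.proj foldrE -map_oclause_to_w -!map_comp.
  by congr foldr; apply: eq_map => s /=; rewrite map_wproj.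
have auxE g m b :
  map_form (foldr ord.Or ord.False
     (map (ord.proj (@wproj K) m) (ord.qf_to_odnf g b)))
  = foldr ord.Or ord.False
     (map (ord.proj (@wproj F) m) (ord.qf_to_odnf (map_form g) b)).
  rewrite foldrE -map_qf_to_odnf -!map_comp; congr foldr.
  by apply: eq_map => c /=; rewrite projE.
elim: f => //=.
- by move=> f -> g ->.
- by move=> f -> g ->.
- by move=> f -> g ->.
- by move=> f ->.
- by move=> m f IHf; rewrite auxE IHf.
- by move=> m f IHf; rewrite (auxE (ord.Not _) m false) /= IHf.
Qed.

(** In a real closed field, the nonnegative elements are the squares. *)
Lemma ltr_rmorph (x y : K) : (i x < i y) = (x < y).
Proof.
have ler (u v : K) : u <= v -> i u <= i v.
  rewrite -subr_ge0 -[i u <= _]subr_ge0 -rmorphB => /sqr_sqrtr <-.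
  by rewrite rmorphXn /= sqr_ge0.
have [/ler|lt_xy] := leP y x; first by rewrite leNgt => /negbTE.
by rewrite lt_neqAle ler ?(ltW lt_xy) // andbT fmorph_eq lt_eqF.
Qed.

Lemma eval_map_gterm e t : GRing.rterm t ->
  GRing.eval (map i e) (map_gterm t) = i (GRing.eval e t).
Proof.
elim: t => //=.
- move=> x _; have [lt_x|ge_x] := ltnP x (size e); first by rewrite (nth_map 0).
  by rewrite !nth_default ?size_map ?rmorph0.
- by move=> m _; rewrite rmorph_nat.
- by move=> u IHu v IHv /andP[/IHu -> /IHv ->]; rewrite rmorphD.
- by move=> u IHu /IHu ->; rewrite rmorphN.
- by move=> u IHu m /IHu ->; rewrite rmorphMn.
- by move=> u IHu v IHv /andP[/IHu -> /IHv ->]; rewrite rmorphM.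
- by move=> u IHu m /IHu ->; rewrite rmorphXn.
Qed.

Lemma qf_eval_map e f : ord.rformula f ->
  ord.qf_eval (map i e) (map_form f) = ord.qf_eval e f.
Proof.
elim: f => //=.
- by move=> u v /andP[ru rv]; rewrite !eval_map_gterm // fmorph_eq.
- by move=> u v /andP[ru rv]; rewrite !eval_map_gterm // ltr_rmorph.
- by move=> u v /andP[ru rv]; rewrite !eval_map_gterm // !leNgt ltr_rmorph.
- by move=> f IHf g IHg /andP[/IHf -> /IHg ->].
- by move=> f IHf g IHg /andP[/IHf -> /IHg ->].
- by move=> f IHf g IHg /andP[/IHf -> /IHg ->].
- by move=> f IHf /IHf ->.
Qed.

Lemma rformula_map f : ord.rformula (map_form f) = ord.rformula f.
Proof.
have rtE t : GRing.rterm (map_gterm t) = GRing.rterm t.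
  by elim: t => //= u -> v ->.
elim: f => //= [u v|u v|u v|f -> g ->|f -> g ->|f -> g ->] //.
all: by rewrite !rtE.
Qed.

(** Quantifiers can be eliminated by the same formula in both fields, and a
    quantifier-free formula is preserved and reflected by an embedding, because
    the embedding is increasing. *)
Theorem transfer_formula e f : ord.rformula f ->
  ord.holds (map i e) (map_form f) <-> ord.holds e f.
Proof.
move=> rf.
have elimP (L : rcfType) := @ord.quantifier_elim_rformP L (@wproj L)
  (@wf_QE_wproj L) (@valid_QE_wproj L).
have /andP[_ rqf] :=
  @ord.quantifier_elim_wf K (@wproj K) (@wf_QE_wproj K) f rf.
split=> [/elimP|/elimP].
  rewrite rformula_map => /(_ rf); rewrite -map_quantifier_elim qf_eval_map //.
  by move/elimP; apply.
move=> /(_ rf) H; apply/elimP; first by rewrite rformula_map.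
by rewrite -map_quantifier_elim qf_eval_map.
Qed.

Lemma holds_foldr_Exists (L : rcfType) (f : ord.formula L) (s : seq nat) e :
  ord.holds e (foldr ord.Exists f s) <->
  exists2 e', (forall j, j \notin s -> e'`_j = e`_j) & ord.holds e' f.
Proof.
elim: s e => [|j s IHs] e /=.
  split=> [fe|[e' ee' fe']]; first by exists e.
  by apply: ord.eq_holds fe' => j; apply: ee'.
split=> [[x /IHs[e' ee' fe']]|[e' ee' fe']].
  exists e' => // l; rewrite inE negb_or => /andP[l_j l_s].
  by rewrite ee' // nth_set_nth /= (negbTE l_j).
exists e'`_j; apply/IHs; exists e' => // l l_s.
by rewrite nth_set_nth /=; case: eqVneq => [->|l_j] //; rewrite ee' // inE negb_or l_j.
Qed.

Definition mpoly_term (L : rcfType) N (q : {mpoly L[N]}) : GRing.term L :=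
  foldr (fun m t => GRing.Add (GRing.Mul (GRing.Const q@_m)
     (foldr (fun j u => GRing.Mul (GRing.Exp (GRing.Var L (val j)) (m j)) u)
        (GRing.NatConst L 1) (index_enum 'I_N))) t)
    (GRing.NatConst L 0) (msupp q).

Lemma rterm_mpoly_term (L : rcfType) N (q : {mpoly L[N]}) :
  GRing.rterm (mpoly_term q).
Proof.
rewrite /mpoly_term; elim: (msupp q) => //= m s ->; rewrite andbT.
by elim: (index_enum _) => //= j t ->.
Qed.

Lemma eval_mpoly_term N (q : {mpoly K[N]}) (e : seq F) :
  GRing.eval e (map_gterm (mpoly_term q))
  = (map_mpoly i q).@[fun j => e`_j].
Proof.
rewrite [q in RHS]mpolyE /mpoly_term.
elim: (msupp q) => [|m s IHs]; first by rewrite !big_nil !raddf0.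
rewrite big_cons /= IHs !raddfD /=; congr (_ + _).
rewrite map_mpolyZ map_mpolyX mevalZ mevalX; congr (_ * _).
elim: (index_enum _) => [|j t IHt]; first by rewrite big_nil.
by rewrite big_cons /= IHt.
Qed.

(** The existence of a zero is a sentence with parameters in [K]. *)
Lemma transfer_mpoly N (q : {mpoly K[N]}) (u : 'I_N -> F) :
  (map_mpoly i q).@[u] = 0 -> exists v : 'I_N -> K, q.@[v] = 0.
Proof.
move=> qu0.
pose f := ord.Equal (mpoly_term q) (GRing.NatConst K 0).
pose g := foldr ord.Exists f (iota 0 N).
have rg : ord.rformula g.
  by rewrite /g; elim: (iota 0 N) => //=; rewrite rterm_mpoly_term.
have gE : map_form g =
    foldr ord.Exists (map_form f) (iota 0 N).
  by rewrite /g; elim: (iota 0 N) => //= j s ->.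
have : ord.holds (map i [::]) (map_form g).
  rewrite gE; apply/holds_foldr_Exists; exists [seq u j | j <- enum 'I_N].
    move=> j; rewrite mem_iota /= add0n -leqNgt => le_Nj.
    by rewrite nth_nil nth_default // size_map size_enum_ord.
  rewrite /= eval_mpoly_term -[RHS]qu0; apply: meval_eq => j.
  by rewrite (nth_map j) ?size_enum_ord // nth_ord_enum.
move=> /transfer_formula -/(_ rg) /holds_foldr_Exists[e _ /= he].
exists (fun j => e`_j); apply: (fmorph_inj i); rewrite rmorph0.
have := eval_map_gterm e (rterm_mpoly_term q).
rewrite he eval_mpoly_term rmorph0 => <-.
rewrite -(meval_map_id q (f := idfun)) // rmorph_meval_map.
apply: eq_meval_map => // j.
have [lt_j|ge_j] := ltnP j (size e); first by rewrite (nth_map 0).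
by rewrite !nth_default ?size_map ?rmorph0.
Qed.

End Naturality.
End QElim.

(** * Hilbert's basis theorem *)

Inductive ideal_gen (A : comNzRingType) (Q : A -> Prop) : A -> Prop :=
| ideal_gen0 : ideal_gen Q 0
| ideal_genMD a q x : Q q -> ideal_gen Q x -> ideal_gen Q (a * q + x).

(** The finite basis is required to consist of given generators: in this form
    the property says that any system of equations is equivalent to a
    finite subsystem. *)
Definition noetherian (A : comNzRingType) : Prop :=
  forall Q : A -> Prop, exists s : seq A,
    (forall x, x \in s -> Q x) /\
    (forall x, Q x -> ideal_gen (fun y => y \in s) x).

Section IdealGen.
Variable A : comNzRingType.
Implicit Types (Q : A -> Prop) (x y a : A).

Lemma ideal_gen_mem Q x : Q x -> ideal_gen Q x.
Proof. by move=> Qx; have := ideal_genMD 1 Qx (ideal_gen0 Q); rewrite mul1r addr0. Qed.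

Lemma ideal_genD Q x y : ideal_gen Q x -> ideal_gen Q y -> ideal_gen Q (x + y).
Proof.
elim=> [|a q {}x Qq _ IHx] Iy; first by rewrite add0r.
by rewrite -addrA; apply: ideal_genMD => //; apply: IHx.
Qed.

Lemma ideal_genM Q a x : ideal_gen Q x -> ideal_gen Q (a * x).
Proof.
elim=> [|b q {}x Qq _ IHx]; first by rewrite mulr0; apply: ideal_gen0.
by rewrite mulrDr mulrA; apply: ideal_genMD.
Qed.

Lemma ideal_genB Q x y : ideal_gen Q x -> ideal_gen Q y -> ideal_gen Q (x - y).
Proof. by move=> Ix Iy; rewrite -mulN1r; apply/ideal_genD/ideal_genM. Qed.

Lemma ideal_genS Q Q' x : (forall y, Q y -> ideal_gen Q' y) ->
  ideal_gen Q x -> ideal_gen Q' x.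
Proof.
move=> sQ; elim=> [|a q {}x Qq _ IHx]; first exact: ideal_gen0.
by apply: ideal_genD => //; apply/ideal_genM/sQ.
Qed.

Lemma ideal_gen_fin Q x : ideal_gen Q x -> exists s : seq A,
  (forall y, y \in s -> Q y) /\ ideal_gen (fun y => y \in s) x.
Proof.
elim=> [|a q {}x Qq _ [s [sQ sx]]]; first by exists [::]; split=> //; apply: ideal_gen0.
exists (q :: s); split=> [y|]; first by rewrite inE => /predU1P[->|/sQ].
apply: ideal_genMD; first by rewrite mem_head.
by apply: ideal_genS sx => y sy; apply: ideal_gen_mem; rewrite inE sy orbT.
Qed.

Lemma ideal_gen_fin_seq Q (t : seq A) : (forall x, x \in t -> ideal_gen Q x) ->
  exists s : seq A, (forall y, y \in s -> Q y) /\
    (forall x, x \in t -> ideal_gen (fun y => y \in s) x).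
Proof.
elim: t => [|x t IHt] Ht; first by exists [::].
have [s1 [s1Q s1x]] := ideal_gen_fin (Ht x (mem_head _ _)).
have [y ty|s2 [s2Q s2t]] := IHt; first by apply: Ht; rewrite inE ty orbT.
exists (s1 ++ s2); split=> y; first by rewrite mem_cat => /orP[/s1Q|/s2Q].
rewrite inE => /predU1P[->|/s2t].
  by apply: ideal_genS s1x => z sz; apply: ideal_gen_mem; rewrite mem_cat sz.
by apply: ideal_genS => z sz; apply: ideal_gen_mem; rewrite mem_cat sz orbT.
Qed.

(** Each member of a finite basis of the ideal is a combination of finitely many
    of the given generators. *)
Lemma noetherian_of_ideals : (forall Q, exists s : seq A,
    (forall x, x \in s -> ideal_gen Q x) /\
    (forall x, ideal_gen Q x -> ideal_gen (fun y => y \in s) x)) ->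
  noetherian A.
Proof.
move=> HA Q; have [t [tI It]] := HA Q.
have [s [sQ st]] := ideal_gen_fin_seq tI.
exists s; split=> // x Qx; apply: ideal_genS (It x _) => //.
exact: ideal_gen_mem.
Qed.

End IdealGen.

Lemma field_noetherian (k : fieldType) : noetherian k.
Proof.
move=> Q; have [[q [Qq q0]]|noq] := pselect (exists q, Q q /\ q != 0).
  exists [:: q]; split=> [x|x _]; first by rewrite inE => /eqP ->.
  rewrite -(divfK q0 x) -[_ * q]addr0.
  by apply: ideal_genMD; [rewrite mem_head | apply: ideal_gen0].
exists [::]; split=> // x Qx; have [->|x0] := eqVneq x 0; first exact: ideal_gen0.
by case: noq; exists x.
Qed.

Lemma noetherian_surj (A B : comNzRingType) (f : {rmorphism A -> B}) :
  (forall b, exists a, f a = b) -> noetherian A -> noetherian B.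
Proof.
move=> fsurj noA Q; have [s [sQ Qs]] := noA (fun a => Q (f a)).
exists (map f s); split=> [x /mapP[a /sQ Qa ->] //|x].
have [a <-] := fsurj x => /Qs.
elim=> [|c q {}a sq _ IHa]; first by rewrite rmorph0; apply: ideal_gen0.
by rewrite rmorphD rmorphM; apply: ideal_genMD => //; apply: map_f.
Qed.

Section HilbertBasis.
Variable A : comNzRingType.
Hypothesis noA : noetherian A.

(** Here [c f] stands for a coefficient of [f]: finitely many polynomials of [I]
    have coefficients that generate those of all polynomials of [I]. *)
Lemma noetherian_lift (I : {poly A} -> Prop) (c : {poly A} -> A) :
  exists s : seq {poly A}, (forall f, f \in s -> I f) /\
    (forall f, I f -> ideal_gen (fun a => exists2 g, g \in s & a = c g) (c f)).
Proof.
have [t [tI It]] := noA (fun a => exists2 f, I f & a = c f).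
have [s [sI ts]] : exists s : seq {poly A}, (forall f, f \in s -> I f) /\
    (forall a, a \in t -> exists2 g, g \in s & a = c g).
  elim: t {It} tI => [|a t IHt] tI; first by exists [::].
  have [f If af] := tI a (mem_head _ _).
  have [b tb|s [sI ts]] := IHt; first by apply: tI; rewrite inE tb orbT.
  exists (f :: s); split=> g; first by rewrite inE => /predU1P[->|/sI].
  rewrite inE => /predU1P[->|/ts[h sh ->]]; first by exists f; rewrite ?mem_head.
  by exists h; rewrite // inE sh orbT.
exists s; split=> // f If.
have : ideal_gen (fun b => b \in t) (c f) by apply: It; exists f.
by apply: ideal_genS => b tb; apply/ideal_gen_mem/ts.
Qed.

(** Let [s2] be polynomials of the ideal whose leading coefficients generate
    all the leading coefficients, and let [d] bound their sizes.  A polynomial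
    of size above [d] loses its leading term by subtracting a combination of
    the elements of [s2] multiplied by powers of the variable.  The polynomials
    of size at most [d] are handled one size after the other, with generators for
    the coefficients in the top degree. *)
Lemma poly_noetherian : noetherian {poly A}.
Proof.
apply: noetherian_of_ideals => Q; pose I := ideal_gen Q.
have size_drop (f g : {poly A}) e : (size f <= e.+1)%N -> (size g <= e.+1)%N ->
    f`_e = g`_e -> (size (f - g)%R <= e)%N.
  move=> szf szg fg; apply/leq_sizeP => j; rewrite leq_eqVlt => /predU1P[<-|lt_ej].
    by rewrite coefB fg subrr.
  by rewrite coefB !nth_default ?subrr // (leq_trans _ lt_ej).
have monoI (s s' : seq {poly A}) f : {subset s <= s'} ->
    ideal_gen (fun y => y \in s) f -> ideal_gen (fun y => y \in s') f.
  by move=> ss; apply: ideal_genS => y sy; apply/ideal_gen_mem/ss.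
have sI (s : seq {poly A}) f : (forall f, f \in s -> I f) ->
    ideal_gen (fun y => y \in s) f -> I f.
  by move=> sI; apply: ideal_genS => y /sI.
have bounded e : exists s : seq {poly A}, (forall f, f \in s -> I f) /\
    (forall f, I f -> (size f <= e)%N -> ideal_gen (fun y => y \in s) f).
  elim: e => [|e [s1 [s1I Is1]]].
    exists [::]; split=> // f _; rewrite leqn0 size_poly_eq0 => /eqP ->.
    exact: ideal_gen0.
  have [s2 [s2I Is2]] :=
    noetherian_lift (fun f => I f /\ (size f <= e.+1)%N) (fun f => f`_e).
  exists (s2 ++ s1); split=> [f|f If szf].
    by rewrite mem_cat => /orP[/s2I[]|/s1I].
  have [g [Ig szg gf]] : exists g, [/\ ideal_gen (fun y => y \in s2) g,
      (size g <= e.+1)%N & g`_e = f`_e].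
    elim: (Is2 f (conj If szf)) => [|a q x [g sg ->] _ [h [Ih szh hx]]].
      by exists 0; split; rewrite ?coef0 ?size_poly0 //; apply: ideal_gen0.
    exists (a%:P * g + h); split; first exact: ideal_genMD.
      rewrite (leq_trans (size_polyD _ _)) // geq_max szh andbT mul_polyC.
      by rewrite (leq_trans (size_scale_leq _ _)) //; case: (s2I g sg).
    by rewrite coefD coefCM hx.
  rewrite -(subrK g f); apply: ideal_genD; last first.
    by apply: monoI Ig => y; rewrite mem_cat => ->.
  apply: (@monoI s1) => [y|]; first by rewrite mem_cat orbC => ->.
  apply: Is1; last exact: size_drop.
  by apply: ideal_genB => //; apply: sI Ig => y /s2I[].
have [s2 [s2I Is2]] := noetherian_lift I lead_coef.
pose d := (\max_(g <- s2) size g)%N.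
have [s1 [s1I Is1]] := bounded d.
exists (s2 ++ s1); split=> [f|f]; first by rewrite mem_cat => /orP[/s2I|/s1I].
have [e] := ubnP (size f); elim: e f => // e IHe f szf If.
have [le_d|gt_d] := leqP (size f) d.
  by apply: (@monoI s1) => [y|]; [rewrite mem_cat orbC => -> | apply: Is1].
have [g [Ig szg gf]] : exists g, [/\ ideal_gen (fun y => y \in s2) g,
    (size g <= (size f).-1.+1)%N & g`_(size f).-1 = f`_(size f).-1].
  rewrite -lead_coefE.
  elim: (Is2 f If) => [|a q x [g sg ->] _ [h [Ih szh hx]]].
    by exists 0; split; rewrite ?coef0 ?size_poly0 //; apply: ideal_gen0.
  have le_gd : (size g <= d)%N by rewrite /d (big_rem g) //= leq_max leqnn.
  have [g0|g_neq0] := eqVneq g 0.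
    by exists h; split=> //; rewrite g0 lead_coef0 mulr0 add0r.
  have szgf : (size g + (size f - size g) = size f)%N.
    by rewrite subnKC // ltnW // (leq_ltn_trans le_gd).
  exists (a%:P * 'X^(size f - size g) * g + h); split; first exact: ideal_genMD.
    rewrite (leq_trans (size_polyD _ _)) // geq_max szh andbT -mulrA mul_polyC.
    rewrite (leq_trans (size_scale_leq _ _)) // mulrC size_mulXn //.
    by rewrite -[X in (_ <= X)%N]/((size f).-1.+1) (ltn_predK gt_d) addnC szgf.
  rewrite coefD -mulrA coefCM hx ['X^_ * _]mulrC coefMXn.
  have -> : ((size f).-1 < size f - size g)%N = false.
    apply/negbTE; rewrite -leqNgt -ltnS (ltn_predK gt_d) -[X in (_ < X)%N]szgf.
    by rewrite -[X in (X < _)%N]add0n ltn_add2r size_poly_gt0.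
  rewrite lead_coefE; congr (_ * g`_ _ + _).
  rewrite -[X in (X.-1 - _)%N]szgf.
  by case: (size g) g_neq0 (size_poly_gt0 g) => [->//|m _ _] /=; rewrite addnK.
rewrite -(subrK g f); apply: ideal_genD; last first.
  by apply: monoI Ig => y; rewrite mem_cat => ->.
apply: IHe; last by apply: ideal_genB => //; apply: sI Ig.
apply: leq_ltn_trans (size_drop _ _ (size f).-1 _ szg (esym gf)) _.
  by rewrite (ltn_predK gt_d).
by rewrite -ltnS (ltn_predK gt_d).
Qed.

End HilbertBasis.

(** Induction on the number of variables: evaluation at the last variable is
    a surjection from the univariate polynomials over [{mpoly k[n]}]. *)
Lemma mpoly_noetherian (k : fieldType) n : noetherian {mpoly k[n]}.
Proof.
elim: n => [|n IHn].
  apply: (@noetherian_surj k _ (@mpolyC 0 k)); last exact: field_noetherian.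
  by move=> p; exists p@_(0%MM); apply: mpolyKC.
pose X : {mpoly k[n.+1]} := 'X_ord_max.
pose f : {rmorphism {poly {mpoly k[n]}} -> {mpoly k[n.+1]}} :=
  horner_eval X \o map_poly (@mwiden n k).
apply: (@noetherian_surj _ _ f); last exact: poly_noetherian.
have fD x y : (exists a, f a = x) -> (exists a, f a = y) -> exists a, f a = x + y.
  by move=> [a <-] [b <-]; exists (a + b); rewrite rmorphD.
have fM x y : (exists a, f a = x) -> (exists a, f a = y) -> exists a, f a = x * y.
  by move=> [a <-] [b <-]; exists (a * b); rewrite rmorphM.
have fC c : exists a, f a = c%:MP.
  by exists (c%:MP)%:P; rewrite /f /= map_polyC /= /horner_eval hornerC mwidenC.
have fX i : exists a, f a = 'X_i.
  case: (unliftP ord_max i) => [j ->|->].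
    exists ('X_j)%:P; rewrite /f /= map_polyC /= /horner_eval hornerC mwidenX.
    rewrite mnmwiden1; congr 'X_[U_(_)]; apply: val_inj => /=.
    by rewrite /bump leqNgt ltn_ord.
  by exists 'X; rewrite /f /= map_polyX /horner_eval hornerX.
move=> p; rewrite [p]mpolyE; elim: (msupp p) => [|m s IHs].
  by rewrite big_nil; exists 0; rewrite rmorph0.
rewrite big_cons; apply: (fD) => //; rewrite -mul_mpolyC; apply: (fM) => //.
rewrite mpolyXE_id; elim: (index_enum _) => [|j t IHt].
  by rewrite big_nil; exists 1; rewrite rmorph1.
rewrite big_cons; apply: (fM) => //; elim: (m j) => [|d IHd].
  by rewrite expr0; exists 1; rewrite rmorph1.
by rewrite exprS; apply: (fM).
Qed.

(** * Transfer of polynomial systems between real closed fields *)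

(** The system is equivalent to a finite one, and over an ordered field a finite
    system is equivalent to the vanishing of one sum of squares. *)
Theorem transfer_zero (K F : rcfType) (i : {rmorphism K -> F}) N
    (Q : {mpoly K[N]} -> Prop) (u : 'I_N -> F) :
  (forall q, Q q -> (map_mpoly i q).@[u] = 0) ->
  exists v : 'I_N -> K, forall q, Q q -> q.@[v] = 0.
Proof.
move=> Qu; have [s [sQ Qs]] := @mpoly_noetherian K N Q.
pose r := \sum_(q <- s) q ^+ 2.
have [v rv] : exists v : 'I_N -> K, r.@[v] = 0.
  apply: (@QElim.transfer_mpoly _ _ i _ _ u).
  rewrite /r big_seq (raddf_sum (map_mpoly i)) (raddf_sum (meval u)).
  rewrite big1 // => q sq.
  by rewrite /= !rmorphXn /= Qu ?expr0n //; apply: sQ.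
exists v => q /Qs; elim=> [|a p x sp _ IHx]; first exact: meval0.
rewrite mevalD mevalM IHx addr0.
move/eqP: rv; rewrite /r (raddf_sum (meval v)) psumr_eq0; last first.
  by move=> j _; rewrite /= rmorphXn sqr_ge0.
by move=> /allP/(_ p sp) /=; rewrite rmorphXn /= sqrf_eq0 => /eqP ->; rewrite mulr0.
Qed.

(** * Laurent polynomials on a split torus *)

Section Monomials.
Variable D : fieldType.

Definition nonvanishing r (w : 'rV[D]_r) : Prop := forall j, w 0 j != 0.
Definition mon r (b : 'rV[int]_r) (w : 'rV[D]_r) : D := \prod_j w 0 j ^ b 0 j.
(** The homomorphism from G_m^r to G_m^m with matrix of exponents [a]. *)
Definition mons r m (a : 'M[int]_(m, r)) (w : 'rV[D]_r) : 'rV[D]_m :=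
  \row_j mon (row j a) w.
Definition rowM r (v w : 'rV[D]_r) : 'rV[D]_r := \row_j (v 0 j * w 0 j).
Definition rowV r (w : 'rV[D]_r) : 'rV[D]_r := \row_j (w 0 j)^-1.

Lemma nonvanishing1 r : nonvanishing (const_mx 1 : 'rV[D]_r).
Proof. by move=> j; rewrite mxE oner_neq0. Qed.

Lemma nonvanishingM r (v w : 'rV_r) :
  nonvanishing v -> nonvanishing w -> nonvanishing (rowM v w).
Proof. by move=> v0 w0 j; rewrite mxE mulf_neq0. Qed.

Lemma nonvanishingV r (w : 'rV_r) : nonvanishing w -> nonvanishing (rowV w).
Proof. by move=> w0 j; rewrite mxE invr_neq0. Qed.

Lemma mon_neq0 r b (w : 'rV_r) : nonvanishing w -> mon b w != 0.
Proof. by move=> w0; apply/prodf_neq0 => j _; rewrite expfz_neq0. Qed.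

Lemma nonvanishing_mons r m (a : 'M_(m, r)) w : nonvanishing w -> nonvanishing (mons a w).
Proof. by move=> w0 j; rewrite mxE mon_neq0. Qed.

Lemma mon0 r (w : 'rV_r) : mon 0 w = 1.
Proof. by rewrite /mon big1 // => j _; rewrite mxE expr0z. Qed.

Lemma mon1 r (b : 'rV_r) : mon b (const_mx 1) = 1.
Proof. by rewrite /mon big1 // => j _; rewrite mxE exp1rz. Qed.

Lemma monD r b c (w : 'rV_r) : nonvanishing w -> mon (b + c) w = mon b w * mon c w.
Proof.
by move=> w0; rewrite /mon -big_split; apply: eq_bigr => j _; rewrite mxE expfzDr.
Qed.

Lemma monM r b (v w : 'rV_r) : mon b (rowM v w) = mon b v * mon b w.
Proof.
by rewrite /mon -big_split; apply: eq_bigr => j _; rewrite mxE expfzMl.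
Qed.

Lemma monV r b (w : 'rV_r) : mon b (rowV w) = (mon b w)^-1.
Proof.
by rewrite /mon -prodfV; apply: eq_bigr => j _; rewrite mxE exprz_inv -invr_expz.
Qed.

Lemma mon_delta r j (w : 'rV_r) : mon (delta_mx 0 j) w = w 0 j.
Proof.
rewrite /mon (bigD1 j) //= big1 ?mulr1 => [|l /negbTE lj]; last first.
  by rewrite mxE lj andbF expr0z.
by rewrite mxE !eqxx expr1z.
Qed.

Lemma mon_mons r m (b : 'rV_m) (a : 'M_(m, r)) w : nonvanishing w ->
  mon b (mons a w) = mon (b *m a) w.
Proof.
move=> w0; rewrite /mon.
under eq_bigr => j _ do rewrite mxE /mon.
transitivity (\prod_l \prod_j w 0 l ^ (b 0 j * a j l)).
  rewrite exchange_big; apply: eq_bigr => j _ /=.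
  rewrite (big_morph (fun x => x ^ b 0 j) (op1 := *%R) (id1 := 1)) => [|x y|].
  - by apply: eq_bigr => l _; rewrite mxE -exprz_exp exprzAC.
  - by rewrite expfzMl.
  - by rewrite exp1rz.
apply: eq_bigr => l _; rewrite mxE.
by rewrite (big_morph (fun x => w 0 l ^ x) (op1 := *%R) (id1 := 1)) // => x y; rewrite expfzDr.
Qed.

Lemma mons_mulmx r m l (c : 'M_(l, m)) (a : 'M_(m, r)) w : nonvanishing w ->
  mons (c *m a) w = mons c (mons a w).
Proof. by move=> w0; apply/rowP => j; rewrite !mxE mon_mons // row_mul. Qed.

Lemma mons1 r (w : 'rV_r) : mons 1%:M w = w.
Proof. by apply/rowP => j; rewrite mxE row1 mon_delta. Qed.

Lemma monsN1 r (w : 'rV_r) : mons (- 1%:M) w = rowV w.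
Proof.
apply/rowP => j; rewrite !mxE /mon (bigD1 j) //= big1 => [|l /negbTE lj].
  by rewrite !mxE eqxx mulr1 exprN1.
by rewrite !mxE eq_sym lj oppr0 expr0z.
Qed.

Lemma monsM r m (a : 'M_(m, r)) v w :
  mons a (rowM v w) = rowM (mons a v) (mons a w).
Proof. by apply/rowP => j; rewrite !mxE monM. Qed.

Lemma monsV r m (a : 'M_(m, r)) w : mons a (rowV w) = rowV (mons a w).
Proof. by apply/rowP => j; rewrite !mxE monV. Qed.

Lemma mons_const1 r m (a : 'M_(m, r)) : mons a (const_mx 1) = const_mx 1.
Proof. by apply/rowP => j; rewrite !mxE mon1. Qed.

End Monomials.

Section MapMonomials.
Variables (k D : fieldType) (f : {rmorphism k -> D}).

Lemma map_mon r b (w : 'rV[k]_r) : mon b (map_mx f w) = f (mon b w).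
Proof.
by rewrite /mon rmorph_prod; apply: eq_bigr => j _; rewrite mxE fmorphXz.
Qed.

Lemma map_mons r m (a : 'M_(m, r)) (w : 'rV[k]_r) :
  mons a (map_mx f w) = map_mx f (mons a w).
Proof. by apply/rowP => j; rewrite !mxE map_mon. Qed.

Lemma nonvanishing_map r (w : 'rV[k]_r) : nonvanishing w -> nonvanishing (map_mx f w).
Proof. by move=> w0 j; rewrite mxE fmorph_eq0. Qed.

End MapMonomials.

Section Independence.
Variables (k : realFieldType) (D : fieldType) (f : {rmorphism k -> D}).

(** The element 2 is not a root of unity in a field with an order, so the points
    with one coordinate 2 and the others 1 separate the monomials. *)
Lemma mon_separated r (b c : 'rV[int]_r) : b != c ->
  exists2 v : 'rV[k]_r, nonvanishing v & mon b v != mon c v.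
Proof.
move=> neq_bc; have /existsP[j bc_j] : [exists j, b 0 j != c 0 j].
  apply: contraR neq_bc; rewrite negb_exists => /forallP H.
  by apply/eqP/rowP => j; apply/eqP; rewrite -[_ == _]negbK.
pose v : 'rV[k]_r := \row_l (if l == j then 2 else 1).
exists v => [l|]; first by rewrite mxE; case: ifP => _; rewrite ?oner_neq0 ?pnatr_eq0.
have vE d : mon d v = 2 ^ d 0 j.
  rewrite /mon (bigD1 j) //= mxE eqxx big1 ?mulr1 // => l /negbTE lj.
  by rewrite mxE lj exp1rz.
rewrite !vE; apply: contra bc_j => /eqP/ieexprIz ->; rewrite ?ltr0n //.
by rewrite pnatr_eq1.
Qed.

(** Dedekind's argument: translating a relation by [v] and subtracting its
    multiple by [mon b0 v] removes the monomial [b0] and keeps any other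
    monomial that takes a different value at [v].  Only points with coordinates
    in [k] are used, whereas the coefficients lie in [D]. *)
Lemma mon_free r (s : seq 'rV[int]_r) (c : 'rV[int]_r -> D) : uniq s ->
  (forall v : 'rV[k]_r, nonvanishing v ->
     \sum_(b <- s) c b * mon b (map_mx f v) = 0) ->
  forall b, b \in s -> c b = 0.
Proof.
elim: s c => [|b0 s IHs] c //= /andP[b0s us] sum0.
have cs b : b \in s -> c b = 0.
  move=> sb; have neq_b : b != b0 by apply: contraNneq b0s => <-.
  have [v v0 neq_v] := mon_separated neq_b.
  have /IHs : forall w : 'rV[k]_r, nonvanishing w ->
      \sum_(b <- s) (c b * (mon b (map_mx f v) - mon b0 (map_mx f v)))
        * mon b (map_mx f w) = 0.
    move=> w w0.
    have := sum0 (rowM v w) (nonvanishingM v0 w0); have := sum0 w w0.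
    have -> : map_mx f (rowM v w) = rowM (map_mx f v) (map_mx f w).
      by apply/rowP => j; rewrite !mxE rmorphM.
    rewrite !big_cons => /eqP; rewrite addr_eq0 => /eqP E0 /eqP.
    rewrite addrC addr_eq0 => /eqP E1.
    rewrite (eq_bigr (fun b => c b * mon b (rowM (map_mx f v) (map_mx f w))
        - mon b0 (map_mx f v) * (c b * mon b (map_mx f w)))); last first.
      move=> d _; rewrite monM !mulrBr mulrBl; congr (_ - _); first by rewrite mulrA.
      by rewrite mulrCA !mulrA.
    rewrite sumrB -mulr_sumr E1 -[X in _ - _ * X]opprK -E0 monM mulrN opprK.
    by rewrite mulrCA addNr.
  move=> /(_ us _ sb)/eqP; rewrite mulf_eq0 subr_eq0 !map_mon fmorph_eq.
  by rewrite (negbTE neq_v) orbF => /eqP.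
move=> b; rewrite inE => /predU1P[->|/cs //].
have := sum0 _ (@nonvanishing1 k r); rewrite big_cons big_seq big1 => [|d sd]; last first.
  by rewrite cs // mul0r.
by rewrite map_mon mon1 rmorph1 mulr1 addr0.
Qed.

End Independence.

Section Laurent.
Variables (A : comNzRingType) (D : fieldType) (f : {rmorphism A -> D}).
Variable r : nat.
Implicit Types (phi psi : 'rV[D]_r -> D).

Definition laurent phi := exists s : seq (A * 'rV[int]_r),
  forall w, nonvanishing w -> phi w = \sum_(t <- s) f t.1 * mon t.2 w.

Lemma laurent_ext phi psi : (forall w, nonvanishing w -> phi w = psi w) ->
  laurent psi -> laurent phi.
Proof. by move=> E [s sE]; exists s => w w0; rewrite E ?sE. Qed.

Lemma laurent_mon b : laurent (mon b).
Proof. by exists [:: (1, b)] => w _; rewrite big_seq1 rmorph1 mul1r. Qed.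

Lemma laurent_const a : laurent (fun=> f a).
Proof. by exists [:: (a, 0)] => w _; rewrite big_seq1 mon0 mulr1. Qed.

Lemma laurentD phi psi : laurent phi -> laurent psi ->
  laurent (fun w => phi w + psi w).
Proof.
by move=> [s sE] [t tE]; exists (s ++ t) => w w0; rewrite big_cat sE ?tE.
Qed.

Lemma laurentM phi psi : laurent phi -> laurent psi ->
  laurent (fun w => phi w * psi w).
Proof.
move=> [s sE] [t tE].
exists [seq (x.1 * y.1, x.2 + y.2) | x <- s, y <- t] => w w0.
rewrite sE // tE // big_allpairs_dep mulr_suml; apply: eq_bigr => x _.
rewrite mulr_sumr; apply: eq_bigr => y _ /=.
by rewrite rmorphM monD // mulrACA.
Qed.

Lemma laurent_sum (I : Type) (s : seq I) (P : pred I) (phi : I -> 'rV[D]_r -> D) :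
  (forall l, laurent (phi l)) -> laurent (fun w => \sum_(l <- s | P l) phi l w).
Proof.
move=> phiL; elim: s => [|l s IHs].
  by exists [::] => w _; rewrite !big_nil.
apply: (@laurent_ext _ (fun w => (if P l then phi l w else 0) +
   \sum_(l <- s | P l) phi l w)) => [w _|].
  by rewrite big_cons; case: ifP => _; rewrite ?add0r.
apply: laurentD => //; case: (P l) => //.
by exists [::] => w _; rewrite big_nil.
Qed.

Lemma laurent_prod (I : Type) (s : seq I) (phi : I -> 'rV[D]_r -> D) :
  (forall l, laurent (phi l)) -> laurent (fun w => \prod_(l <- s) phi l w).
Proof.
move=> phiL; elim: s => [|l s IHs].
  by apply: laurent_ext (laurent_const 1) => w _; rewrite big_nil rmorph1.
by apply: laurent_ext (laurentM (phiL l) IHs) => w _; rewrite big_cons.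
Qed.

Lemma laurentX phi m : laurent phi -> laurent (fun w => phi w ^+ m).
Proof.
move=> phiL; apply: laurent_ext (laurent_prod (iota 0 m) (fun=> phiL)) => w _.
by rewrite big_const_seq count_predT size_iota iter_mulr_1.
Qed.

Lemma laurent_meval N (p : {mpoly A[N]}) (x : 'rV[D]_r -> 'I_N -> D) :
  (forall j, laurent (fun w => x w j)) ->
  laurent (fun w => (map_mpoly f p).@[x w]).
Proof.
move=> xL.
apply: (@laurent_ext _ (fun w => \sum_(m <- msupp p)
   f p@_m * \prod_j x w j ^+ m j)) => [w _|].
  exact: meval_mapE.
apply: laurent_sum => m; apply: laurentM; first exact: laurent_const.
by apply: laurent_prod => j; apply: laurentX.
Qed.

Lemma laurent_diag_mx i j : laurent (fun w => diag_mx w i j).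
Proof.
case: (eqVneq i j) => [->|ij].
  by apply: laurent_ext (laurent_mon (delta_mx 0 j)) => w _;
     rewrite mxE eqxx mulr1n mon_delta.
by apply: laurent_ext (laurent_const 0) => w _; rewrite mxE (negbTE ij) rmorph0.
Qed.

Lemma laurent_mulmx m n p q (B : 'M[A]_(m, n)) (F : 'rV[D]_r -> 'M[D]_(n, p))
    (C : 'M[A]_(p, q)) : (forall i j, laurent (fun w => F w i j)) ->
  forall i j, laurent (fun w => (map_mx f B *m F w *m map_mx f C) i j).
Proof.
move=> FL i j.
apply: (@laurent_ext _ (fun w =>
   \sum_l (\sum_l' f (B i l') * F w l' l) * f (C l j))) => [w _|].
  rewrite !mxE; apply: eq_bigr => l _; rewrite !mxE; congr (_ * _).
  by apply: eq_bigr => l' _; rewrite mxE.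
apply: laurent_sum => l; apply: laurentM; last exact: laurent_const.
by apply: laurent_sum => l'; apply: laurentM; first exact: laurent_const.
Qed.

(** Collecting equal exponents, so that the independence of monomials applies. *)
Lemma laurent_collect phi : laurent phi ->
  exists (s : seq 'rV[int]_r) (c : 'rV[int]_r -> A), uniq s /\
    forall w, nonvanishing w -> phi w = \sum_(b <- s) f (c b) * mon b w.
Proof.
move=> [s sE]; exists (undup (map snd s)), (fun b => \sum_(t <- s | t.2 == b) t.1).
split=> [|w w0]; first exact: undup_uniq.
rewrite sE //; under [RHS]eq_bigr => b _ do rewrite rmorph_sum mulr_suml big_mkcond.
rewrite exchange_big /= big_seq [RHS]big_seq; apply: eq_bigr => t st.
rewrite (bigD1_seq t.2) ?undup_uniq ?mem_undup ?map_f //= eqxx big1 ?addr0 // => b.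
by rewrite eq_sym => /negbTE ->.
Qed.

End Laurent.

Lemma laurent_mons (A : comNzRingType) (D : fieldType) (f : {rmorphism A -> D})
    r m (psi : 'rV[D]_m -> D) (a : 'M[int]_(m, r)) :
  laurent f psi -> laurent f (fun w => psi (mons a w)).
Proof.
move=> [s sE]; exists [seq (t.1, t.2 *m a) | t <- s] => w w0.
rewrite big_map sE; last exact: nonvanishing_mons.
by apply: eq_bigr => t _; rewrite mon_mons.
Qed.

Section LaurentPoints.
Variables (k : realFieldType) (D : fieldType) (f : {rmorphism k -> D}).
Variables (A : comNzRingType) (g : {rmorphism A -> D}).

(** The points with coordinates in [k] already force the coefficients to vanish. *)
Lemma laurent_dense r (phi : 'rV[D]_r -> D) : laurent g phi ->
  (forall v : 'rV[k]_r, nonvanishing v -> phi (map_mx f v) = 0) ->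
  forall w, nonvanishing w -> phi w = 0.
Proof.
move=> /laurent_collect[s [c [us sE]]] phi0 w w0; rewrite sE // big_seq big1 // => b sb.
rewrite (mon_free (f := f) (c := fun b => g (c b)) us) ?mul0r // => v v0.
by rewrite -sE ?phi0 //; apply: nonvanishing_map.
Qed.

(** A character that is a combination of monomials is one of them, since distinct
    characters are linearly independent. *)
Lemma laurent_character_monomial r (phi : 'rV[D]_r -> D) : laurent g phi ->
  (forall v w, nonvanishing v -> nonvanishing w ->
     phi (rowM v w) = phi v * phi w) -> phi (const_mx 1) = 1 ->
  exists b, forall w, nonvanishing w -> phi w = mon b w.
Proof.
move=> /laurent_collect[s [c [us sE]]] phiM phi1.
(* Compare the coefficients of the monomials in the first factor of a product. *)
have coefE b w : b \in s -> nonvanishing w -> g (c b) * (mon b w - phi w) = 0.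
  move=> sb w0; apply: (mon_free (f := f) (s := s)
    (c := fun b => g (c b) * (mon b w - phi w))) sb => // v v0.
  have fv0 := nonvanishing_map f v0.
  have := phiM _ _ fv0 w0; rewrite !sE //; last exact: nonvanishingM.
  move/eqP; rewrite -subr_eq0 mulr_suml -sumrB => /eqP E; rewrite -[RHS]E.
  apply: eq_bigr => b' _; rewrite monM mulrBr mulrBl -sE //.
  by rewrite !mulrA; congr (_ - _); rewrite mulrAC.
have [b sb cb] : exists2 b, b \in s & g (c b) != 0.
  have [/hasP[b sb cb]|/hasPn no] := boolP (has (fun b => g (c b) != 0) s).
    by exists b.
  move/eqP: phi1; rewrite sE; last exact: nonvanishing1.
  rewrite big_seq big1 => [|b sb]; first by rewrite eq_sym oner_eq0.
  by have := no b sb; rewrite negbK => /eqP ->; rewrite mul0r.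
exists b => w w0; have /eqP := coefE b w sb w0.
by rewrite mulf_eq0 (negbTE cb) subr_eq0 => /eqP.
Qed.

(** The coordinate [w 0 l] is a combination of the monomials with exponents [b *m a].
    By independence, its own exponent vector is one of these; the vectors [b]
    found in this way are the rows of [c]. *)
Lemma laurent_retraction r m (a : 'M[int]_(m, r)) (F : 'I_r -> 'rV[D]_m -> D) :
  (forall l, laurent g (F l)) ->
  (forall w l, nonvanishing w -> F l (mons a w) = w 0 l) ->
  exists c : 'M[int]_(r, m), c *m a = 1%:M.
Proof.
move=> FL FE.
have rowE l : exists b : 'rV[int]_m, b *m a = delta_mx 0 l.
  have [s sE] := FL l.
  pose phi (w : 'rV[D]_r) := \sum_(t <- s) g t.1 * mon (t.2 *m a) w.
  have [//|no] := pselect (exists b : 'rV[int]_m, b *m a = delta_mx 0 l).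
  have phiE w : nonvanishing w -> phi w = w 0 l.
    move=> w0; rewrite -FE // sE; last exact: nonvanishing_mons.
    by apply: eq_bigr => t _; rewrite mon_mons.
  pose s' := undup [seq t.2 *m a | t <- s].
  pose c b := \sum_(t <- s | t.2 *m a == b) g t.1.
  have phiE' w : phi w = \sum_(b <- s') c b * mon b w.
    under [RHS]eq_bigr => b _ do rewrite mulr_suml big_mkcond.
    rewrite exchange_big /= /phi big_seq [RHS]big_seq; apply: eq_bigr => t st.
    rewrite (bigD1_seq (t.2 *m a)) ?undup_uniq ?mem_undup ?map_f //=; last first.
      by apply/mapP; exists t.
    by rewrite eqxx big1 ?addr0 // => b; rewrite eq_sym => /negbTE ->.
  have ds' : delta_mx 0 l \notin s'.
    by rewrite mem_undup; apply/mapP => -[t _ tE]; case: no; exists t.2.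
  pose c' b := if b == delta_mx 0 l then -1 else c b.
  have /eqP : c' (delta_mx 0 l) = 0.
    apply: (mon_free (f := f) (s := delta_mx 0 l :: s')); last exact: mem_head.
      by rewrite /= ds' undup_uniq.
    move=> v v0; rewrite big_cons /c' eqxx mon_delta mulN1r.
    rewrite (eq_big_seq (fun b => c b * mon b (map_mx f v))) => [|b sb].
      by rewrite -phiE' phiE ?addNr //; apply: nonvanishing_map.
    by case: eqVneq sb => // ->; rewrite (negbTE ds').
  by rewrite /c' eqxx oppr_eq0 oner_eq0.
have [c cE] := choice rowE.
exists (\matrix_l c l); apply/row_matrixP => l.
by rewrite row_mul rowK cE row1.
Qed.

End LaurentPoints.

(** The list of arguments of a polynomial in the entries of a matrix and the
    inverse of its determinant; [gl_coords] is the case where [d] is this inverse.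
    Keeping [d] separate makes the list meaningful over polynomial rings, where the
    determinant has no inverse. *)
Definition coords (A : pzRingType) n (g : 'M[A]_n) (d : A) : 'I_(n * n + 1) -> A :=
  row_mx (mxvec g) (const_mx d) 0.

Lemma coords_map (A B : pzRingType) (f : A -> B) n (g : 'M[A]_n) d l :
  f (coords g d l) = coords (map_mx f g) (f d) l.
Proof.
rewrite /coords; case: (split_ordP l) => [l' ->|l' ->]; last by rewrite !row_mxEr !mxE.
by case/mxvec_indexP: l' => i j; rewrite !row_mxEl !mxvecE mxE.
Qed.

Lemma laurent_coords (k D : fieldType) (f : {rmorphism k -> D}) n
    (p : {mpoly k[n * n + 1]}) (h : 'M[k]_n) : h \in unitmx ->
  laurent f (fun w : 'rV[D]_n =>
    let g := map_mx f h *m diag_mx w *m invmx (map_mx f h) in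
    (map_mpoly f p).@[coords g (\det g)^-1]).
Proof.
move=> uh; apply: laurent_meval => l.
rewrite /coords; case: (split_ordP l) => [l' ->|l' ->].
  case/mxvec_indexP: l' => i j.
  have := laurent_mulmx h (invmx h) (@laurent_diag_mx _ _ f n) i j.
  by apply: laurent_ext => w _; rewrite row_mxEl mxvecE map_invmx.
apply: (@laurent_ext _ _ _ _ _ (mon (const_mx (-1)))); last exact: laurent_mon.
move=> w w0; rewrite row_mxEr mxE !det_mulmx mulrAC det_inv mulrV ?mul1r.
  by rewrite det_diag -prodfV; apply: eq_bigr => j _; rewrite mxE exprN1.
by rewrite -unitmxE map_unitmx.
Qed.

(** * Split tori *)

Local Open Scope classical_set_scope.

Section DiagonalTori.
Variables (D : fieldType) (n e : nat).
Implicit Types (h : 'M[D]_n) (a : 'M[int]_(n, e)) (y : 'rV[D]_e).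

(** The columns of [h] are eigenvectors of the torus, and the rows of [a] are the
    weights of the torus on them. *)
Definition tor h a y : 'M[D]_n := h *m diag_mx (mons a y) *m invmx h.
Definition torus_of h a : set 'M[D]_n := [set tor h a y | y in @nonvanishing D e].

Lemma diag_mx_rowM r (v w : 'rV[D]_r) :
  diag_mx (rowM v w) = diag_mx v *m diag_mx w.
Proof. by rewrite mulmx_diag. Qed.

Lemma diag_mx_rowV r (w : 'rV[D]_r) : nonvanishing w ->
  diag_mx w *m diag_mx (rowV w) = 1%:M.
Proof.
move=> w0; rewrite -diag_mx_rowM -diag_const_mx; congr diag_mx.
by apply/rowP => j; rewrite !mxE divff.
Qed.

Lemma unit_diag_mx r (w : 'rV[D]_r) : nonvanishing w -> diag_mx w \in unitmx.
Proof. by move=> /diag_mx_rowV/mulmx1_unit[]. Qed.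

Lemma invmx_diag r (w : 'rV[D]_r) : nonvanishing w ->
  invmx (diag_mx w) = diag_mx (rowV w).
Proof.
move=> w0; rewrite -[RHS](mulKmx (unit_diag_mx w0)) diag_mx_rowV //.
by rewrite mulmx1.
Qed.

Lemma torM h a y z : h \in unitmx -> tor h a (rowM y z) = tor h a y *m tor h a z.
Proof. by move=> uh; rewrite /tor monsM diag_mx_rowM !mulmxA mulmxKV. Qed.

Lemma tor1 h a : h \in unitmx -> tor h a (const_mx 1) = 1%:M.
Proof. by move=> uh; rewrite /tor mons_const1 diag_const_mx mulmx1 mulmxV. Qed.

Lemma unit_tor h a y : h \in unitmx -> nonvanishing y -> tor h a y \in unitmx.
Proof.
by move=> uh y0; rewrite !unitmx_mul unitmx_inv uh unit_diag_mx //; apply: nonvanishing_mons.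
Qed.

Lemma torV h a y : h \in unitmx -> nonvanishing y ->
  invmx (tor h a y) = tor h a (rowV y).
Proof.
move=> uh y0; have y1 : rowM y (rowV y) = const_mx 1.
  by apply/rowP => j; rewrite !mxE divff.
rewrite -[RHS](mulKmx (unit_tor a uh y0)) -torM // y1 tor1 //.
by rewrite mulmx1.
Qed.

Lemma det_tor h a y : h \in unitmx -> \det (tor h a y) = \prod_j mons a y 0 j.
Proof.
move=> uh; rewrite /tor !det_mulmx mulrAC det_inv mulrV ?mul1r ?det_diag // -?unitmxE.
Qed.

Lemma tor_conj h a y : h \in unitmx ->
  invmx h *m tor h a y *m h = diag_mx (mons a y).
Proof. by move=> uh; rewrite /tor !mulmxA mulVmx // mul1mx mulmxKV. Qed.

Lemma tor_inj h a (c : 'M_(e, n)) y z : h \in unitmx -> c *m a = 1%:M ->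
  nonvanishing y -> nonvanishing z -> tor h a y = tor h a z -> y = z.
Proof.
move=> uh ca y0 z0 E; have : diag_mx (mons a y) = diag_mx (mons a z).
  by rewrite -(tor_conj a y uh) -(tor_conj a z uh) E.
move=> /matrixP Ed; have {Ed} Ea : mons a y = mons a z.
  by apply/rowP => j; have := Ed j j; rewrite !mxE eqxx !mulr1n.
by rewrite -[y]mons1 -[z]mons1 -ca !mons_mulmx // Ea.
Qed.

End DiagonalTori.

Lemma map_tor (k D : fieldType) (f : {rmorphism k -> D}) n e (h : 'M[k]_n)
    (a : 'M_(n, e)) y :
  map_mx f (tor h a y) = tor (map_mx f h) a (map_mx f y).
Proof. by rewrite /tor !map_mxM map_diag_mx map_invmx map_mons. Qed.

Lemma laurent_tor_entry (k D : fieldType) (f : {rmorphism k -> D}) n e d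
    (h : 'M[k]_n) (a : 'M[int]_(n, e)) (M : 'M[int]_(e, d)) i j :
  laurent f (fun x => tor (map_mx f h) a (mons M x) i j).
Proof.
apply: (@laurent_mons _ _ f _ _ (fun y => tor (map_mx f h) a y i j)).
apply: (@laurent_mons _ _ f _ _ (fun w =>
  (map_mx f h *m diag_mx w *m invmx (map_mx f h)) i j)).
by rewrite -map_invmx; apply: laurent_mulmx; apply: laurent_diag_mx.
Qed.

Section RegularFunctions.
Variables (D : closedFieldType) (k : fieldType) (f : {rmorphism k -> D}) (n : nat).
Implicit Types (g : 'M[D]_n) (phi psi : 'M[D]_n -> D).

Definition regular phi := exists p : {mpoly k[n * n + 1]},
  forall g, g \in unitmx -> eval_over f p g = phi g.

Lemma regular_ext phi psi : (forall g, g \in unitmx -> phi g = psi g) ->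
  regular psi -> regular phi.
Proof. by move=> E [p pE]; exists p => g ug; rewrite E ?pE. Qed.

Lemma regular_const c : regular (fun=> f c).
Proof. by exists c%:MP => g _; rewrite /eval_over map_mpolyC mevalC. Qed.

Lemma regularD phi psi : regular phi -> regular psi -> regular (fun g => phi g + psi g).
Proof.
move=> [p pE] [q qE]; exists (p + q) => g ug.
by rewrite /eval_over !raddfD /= -!/(eval_over _ _ _) pE ?qE.
Qed.

Lemma regularM phi psi : regular phi -> regular psi -> regular (fun g => phi g * psi g).
Proof.
move=> [p pE] [q qE]; exists (p * q) => g ug.
by rewrite /eval_over !rmorphM /= -!/(eval_over _ _ _) pE ?qE.
Qed.

Lemma regular_entry i j : regular (fun g => g i j).
Proof.
exists 'X_(lshift 1 (mxvec_index i j)) => g _.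
by rewrite /eval_over map_mpolyX mevalXU /gl_coords row_mxEl mxvecE.
Qed.

Lemma regular_detV : regular (fun g => (\det g)^-1).
Proof.
exists 'X_(rshift (n * n) 0) => g _.
by rewrite /eval_over map_mpolyX mevalXU /gl_coords row_mxEr mxE.
Qed.

Lemma regular_sum (I : Type) (s : seq I) (P : pred I) (phi : I -> 'M[D]_n -> D) :
  (forall l, regular (phi l)) -> regular (fun g => \sum_(l <- s | P l) phi l g).
Proof.
move=> phiR; elim: s => [|l s IHs].
  by apply: regular_ext (regular_const 0) => g _; rewrite big_nil rmorph0.
have [Pl|nPl] := boolP (P l).
  by apply: regular_ext (regularD (phiR l) IHs) => g _; rewrite big_cons Pl.
by apply: regular_ext IHs => g _; rewrite big_cons (negbTE nPl).
Qed.

Lemma regular_prod (I : Type) (s : seq I) (phi : I -> 'M[D]_n -> D) :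
  (forall l, regular (phi l)) -> regular (fun g => \prod_(l <- s) phi l g).
Proof.
move=> phiR; elim: s => [|l s IHs].
  by apply: regular_ext (regular_const 1) => g _; rewrite big_nil rmorph1.
by apply: regular_ext (regularM (phiR l) IHs) => g _; rewrite big_cons.
Qed.

Lemma regularX phi m : regular phi -> regular (fun g => phi g ^+ m).
Proof.
move=> phiR; apply: regular_ext (regular_prod (iota 0 m) (fun=> phiR)) => g _.
by rewrite big_const_seq count_predT size_iota iter_mulr_1.
Qed.

Lemma regular_sign m : regular (fun=> (-1) ^+ m).
Proof.
apply: (regular_ext _ (@regular_const ((-1) ^+ m))) => g _.
by rewrite rmorph_sign.
Qed.

Lemma regular_det m (M : 'M[D]_n -> 'M[D]_m) :
  (forall i j, regular (fun g => M g i j)) -> regular (fun g => \det (M g)).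
Proof.
move=> MR; apply: regular_sum => s; apply: regularM.
  exact: regular_sign.
by apply: regular_prod => i; apply: MR.
Qed.

Lemma regular_inv i j : regular (fun g => invmx g i j).
Proof.
apply: (@regular_ext _ (fun g => (\det g)^-1 * \adj g i j)) => [g ug|].
  by rewrite /invmx ug mxE.
apply: regularM regular_detV _.
apply: (@regular_ext _ (fun g =>
   (-1) ^+ (j + i) * \det (row' j (col' i g)))) => [g _|].
  by rewrite mxE.
apply: regularM; first exact: regular_sign.
apply: regular_det => i' j'; apply: regular_ext (regular_entry _ _) => g _.
by rewrite !mxE.
Qed.

End RegularFunctions.

(** An integral power that is polynomial in [x] and [xV], meant for [xV] inverse
    to [x]. *)
Definition zpow (A : comNzRingType) (x xV : A) (z : int) : A :=
  match z with Posz m => x ^+ m | Negz m => xV ^+ m.+1 end.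

Lemma zpowE (D : fieldType) (x : D) z : zpow x x^-1 z = x ^ z.
Proof. by case: z => m //=; rewrite NegzE exprVn -exprnN. Qed.

Lemma regular_zpow (D : closedFieldType) (k : fieldType) (f : {rmorphism k -> D})
    n (phi psi : 'M[D]_n -> D) z :
  regular f phi -> regular f psi -> regular f (fun g => zpow (phi g) (psi g) z).
Proof. by case: z => m phiR psiR; apply: regularX. Qed.

Lemma regular_mx (D : closedFieldType) (k : fieldType) (f : {rmorphism k -> D})
    n m (F : 'M[D]_n -> 'M[D]_m) :
  (forall i j, regular f (fun g => F g i j)) ->
  exists P : 'I_m -> 'I_m -> {mpoly k[n * n + 1]}, forall g, g \in unitmx ->
    F g = \matrix_(i, j) eval_over f (P i j) g.
Proof.
move=> FR; have FR' i : exists Pi : 'I_m -> {mpoly k[n * n + 1]},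
    forall j g, g \in unitmx -> eval_over f (Pi j) g = F g i j.
  by have [Pi PiE] := choice (FR i); exists Pi.
have [P PE] := choice FR'; exists P => g ug; apply/matrixP => i j.
by rewrite mxE PE.
Qed.

Lemma regular_mulmx (D : closedFieldType) (k : fieldType) (f : {rmorphism k -> D})
    n m p q (F : 'M[D]_n -> 'M[D]_(m, p)) (F' : 'M[D]_n -> 'M[D]_(p, q)) :
  (forall i j, regular f (fun g => F g i j)) ->
  (forall i j, regular f (fun g => F' g i j)) ->
  forall i j, regular f (fun g => (F g *m F' g) i j).
Proof.
move=> FR FR' i j.
apply: (@regular_ext _ _ _ _ _ (fun g => \sum_l F g i l * F' g l j)) => [g _|].
  by rewrite mxE.
by apply: regular_sum => l; apply: regularM.
Qed.

Lemma regular_constmx (D : closedFieldType) (k : fieldType) (f : {rmorphism k -> D})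
    n m p (M : 'M[k]_(m, p)) i j :
  regular f (fun _ : 'M[D]_n => map_mx f M i j).
Proof. by apply: regular_ext (@regular_const _ _ f n (M i j)) => g _; rewrite mxE. Qed.

Lemma regular_diag_mx (D : closedFieldType) (k : fieldType) (f : {rmorphism k -> D})
    n m (w : 'M[D]_n -> 'rV[D]_m) :
  (forall j, regular f (fun g => w g 0 j)) ->
  forall i j, regular f (fun g => diag_mx (w g) i j).
Proof.
move=> wR i j; apply: (@regular_ext _ _ _ _ _ (fun g => w g 0 i * (i == j)%:R)).
  by move=> g _; rewrite mxE mulr_natr.
apply: regularM => //; apply: regular_ext (@regular_const _ _ f n (i == j)%:R) => g _.
by rewrite rmorph_nat.
Qed.

Section SplitTorusOf.
Variables (D : closedFieldType) (k : fieldType) (f : {rmorphism k -> D}).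
Variables (n e : nat) (h : 'M[k]_n) (a : 'M[int]_(n, e)) (c : 'M[int]_(e, n)).
Hypotheses (uh : h \in unitmx) (ca : c *m a = 1%:M).

Let H := map_mx f h.
Let T := torus_of H a.

Let uH : H \in unitmx. Proof. by rewrite map_unitmx. Qed.

Let expand (u uV : 'rV[D]_e) : 'M[D]_n :=
  H *m diag_mx (\row_j \prod_l zpow (u 0 l) (uV 0 l) (a j l)) *m invmx H.

Let expandE u : expand u (rowV u) = tor H a u.
Proof.
rewrite /expand /tor; congr (_ *m diag_mx _ *m _); apply/rowP => j.
by rewrite !mxE; apply: eq_bigr => l _; rewrite !mxE zpowE.
Qed.

Let regular_expand m (u uV : 'M[D]_m -> 'rV[D]_e) :
  (forall l, regular f (fun g => u g 0 l)) ->
  (forall l, regular f (fun g => uV g 0 l)) ->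
  forall i j, regular f (fun g => expand (u g) (uV g) i j).
Proof.
move=> uR uVR; apply: regular_mulmx; last first.
  move=> i j; apply: regular_ext (regular_constmx _ _ (invmx h) i j) => g _.
  by rewrite map_invmx.
apply: regular_mulmx; first exact: regular_constmx.
apply: regular_diag_mx => j.
apply: (@regular_ext _ _ _ _ _ (fun g => \prod_l zpow (u g 0 l) (uV g 0 l) (a j l))).
  by move=> g _; rewrite mxE.
by apply: regular_prod => l; apply: regular_zpow.
Qed.

Let w (g : 'M[D]_n) j := (invmx H *m g *m H) j j.
Let u (g : 'M[D]_n) : 'rV[D]_e :=
  \row_l \prod_j zpow (w g j) (w (invmx g) j) (c l j).
Let uV (g : 'M[D]_n) : 'rV[D]_e :=
  \row_l \prod_j zpow (w (invmx g) j) (w g j) (c l j).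

Let regular_w (F : 'M[D]_n -> 'M[D]_n) j :
  (forall i j, regular f (fun g => F g i j)) -> regular f (fun g => w (F g) j).
Proof.
move=> FR; apply: regular_mulmx; last exact: regular_constmx.
apply: regular_mulmx => // i i'.
apply: regular_ext (regular_constmx _ _ (invmx h) i i') => g _.
by rewrite map_invmx.
Qed.

Let regular_u l : regular f (fun g => u g 0 l).
Proof.
apply: (@regular_ext _ _ _ _ _ (fun g =>
   \prod_j zpow (w g j) (w (invmx g) j) (c l j))) => [g _|]; first by rewrite mxE.
apply: regular_prod => j; apply: regular_zpow; apply: regular_w => i i'.
  exact: regular_entry.
exact: regular_inv.
Qed.

Let regular_uV l : regular f (fun g => uV g 0 l).
Proof.
apply: (@regular_ext _ _ _ _ _ (fun g =>
   \prod_j zpow (w (invmx g) j) (w g j) (c l j))) => [g _|]; first by rewrite mxE.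
apply: regular_prod => j; apply: regular_zpow; apply: regular_w => i i'.
  exact: regular_inv.
exact: regular_entry.
Qed.

Let w_tor y j : w (tor H a y) j = mons a y 0 j.
Proof. by rewrite /w tor_conj // mxE eqxx mulr1n. Qed.

Let w_torV y j : nonvanishing y -> w (invmx (tor H a y)) j = (mons a y 0 j)^-1.
Proof. by move=> y0; rewrite torV // w_tor monsV mxE. Qed.

Let u_tor y : nonvanishing y -> u (tor H a y) = y.
Proof.
move=> y0; rewrite -[RHS]mons1 -ca mons_mulmx //; apply/rowP => l.
rewrite !mxE; apply: eq_bigr => j _.
by rewrite w_torV // w_tor zpowE !mxE.
Qed.

Let uV_tor y : nonvanishing y -> uV (tor H a y) = rowV y.
Proof.
move=> y0; rewrite -[y in RHS]mons1 -ca mons_mulmx // -monsV; apply/rowP => l.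
rewrite !mxE; apply: eq_bigr => j _.
by rewrite w_torV // w_tor -[X in zpow _ X]invrK zpowE !mxE.
Qed.

Lemma torus_of_unit g : T g -> g \in unitmx.
Proof. by move=> [y y0 <-]; apply: unit_tor. Qed.

Lemma torus_of_group1 : T 1%:M.
Proof. by exists (const_mx 1); [apply: nonvanishing1 | rewrite tor1]. Qed.

Lemma torus_of_groupM g g' : T g -> T g' -> T (g *m g').
Proof.
move=> [y y0 <-] [z z0 <-]; exists (rowM y z); first exact: nonvanishingM.
by rewrite torM.
Qed.

Lemma torus_of_groupV g : T g -> T (invmx g).
Proof. by move=> [y y0 <-]; exists (rowV y); [apply: nonvanishingV | rewrite torV]. Qed.

(** On the torus, [u g] recovers the parameter of [g] from its eigenvalues, [uV g]
    is its inverse, and [g] is the point with this parameter.  These identities are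
    equations over [k], and a matrix that satisfies them is in the torus. *)
Lemma torus_of_defined : defined_over f T.
Proof.
exists [set p | forall g, T g -> eval_over f p g = 0]; apply/seteqP; split=> g.
  by move=> Tg; split=> [|p]; [apply: torus_of_unit | apply].
move=> [ug Eg].
have vanish phi : regular f phi -> (forall g, T g -> phi g = 0) -> phi g = 0.
  move=> [p pE] phi0; rewrite -pE //; apply: Eg => g' Tg'.
  by rewrite pE ?phi0 //; apply: torus_of_unit.
have regularB phi psi : regular f phi -> regular f psi ->
    regular f (fun g : 'M[D]_n => phi g - psi g).
  move=> phiR psiR; apply: (@regular_ext _ _ _ _ _ (fun g => phi g + (-1) * psi g)).
    by move=> g' _; rewrite mulN1r.
  apply: regularD => //; apply: regularM => //.
  by apply: regular_ext (regular_sign f n 1) => g' _; rewrite expr1.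
have uuV l : u g 0 l * uV g 0 l = 1.
  apply/eqP; rewrite -subr_eq0; apply/eqP.
  apply: (vanish (fun g => u g 0 l * uV g 0 l - 1)) => [|_ [y y0 <-]].
    apply: regularB; first exact: regularM.
    by apply: regular_ext (regular_sign f n 0) => g' _; rewrite expr0.
  by rewrite u_tor // uV_tor // mxE divff ?subrr.
have u0 : nonvanishing (u g).
  by move=> l; apply: contra_eq_neq (uuV l) => ->; rewrite mul0r eq_sym oner_eq0.
exists (u g) => //; rewrite -expandE.
have <- : uV g = rowV (u g).
  by apply/rowP => l; rewrite [RHS]mxE -[LHS](mulKf (u0 l)) uuV mulr1.
apply/matrixP => i j; apply/eqP; rewrite -subr_eq0; apply/eqP.
apply: (vanish (fun g => expand (u g) (uV g) i j - g i j)) => [|_ [y y0 <-]].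
  apply: regularB; last exact: regular_entry.
  exact: regular_expand.
by rewrite u_tor // uV_tor // expandE subrr.
Qed.

(** The relation [c *m a = 1%:M] says that the parameters are monomials in the
    eigenvalues, with exponents the rows of [c]. *)
Lemma torus_of_iso : isomorphic_over f T (Gm_pow D e).
Proof.
pose F g := diag_mx (u g).
pose F' (t : 'M[D]_e) := expand (\row_l t l l) (\row_l invmx t l l).
have F'E v : nonvanishing v -> F' (diag_mx v) = tor H a v.
  move=> v0; rewrite /F' invmx_diag // -expandE; congr expand; apply/rowP => l.
    by rewrite !mxE eqxx mulr1n.
  by rewrite !mxE eqxx mulr1n.
exists F, F'; split.
- split.
  + have [P PE] := regular_mx (regular_diag_mx regular_u).
    by exists P => g /torus_of_unit/PE.
  + by move=> _ [y y0 <-]; exists y => //; rewrite /F u_tor.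
  + move=> _ _ [y y0 <-] [z z0 <-].
    by rewrite -torM // /F !u_tor // ?diag_mx_rowM //; apply: nonvanishingM.
- split.
  + have F'R i j : regular f (fun t => F' t i j).
      apply: regular_expand => l.
        by apply: regular_ext (regular_entry f l l) => g _; rewrite mxE.
      by apply: regular_ext (regular_inv f l l) => g _; rewrite mxE.
    have [P PE] := regular_mx F'R.
    by exists P => _ [v v0 <-]; apply/PE/unit_diag_mx.
  + by move=> _ [v v0 <-]; exists v => //; rewrite F'E.
  + move=> _ _ [v v0 <-] [v' v'0 <-].
    by rewrite -diag_mx_rowM !F'E ?torM //; apply: nonvanishingM.
- by move=> _ [y y0 <-]; rewrite /F u_tor // F'E.
- by move=> _ [v v0 <-]; rewrite F'E // /F u_tor.
Qed.

End SplitTorusOf.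

Lemma map_mx_idfun (D : fieldType) n (h : 'M[D]_n) : map_mx idfun h = h.
Proof. by apply/matrixP => i j; rewrite mxE. Qed.

Lemma split_torus_of (D : closedFieldType) (k : fieldType) (f : {rmorphism k -> D})
    n e (h : 'M[k]_n) (a : 'M[int]_(n, e)) (c : 'M[int]_(e, n)) :
  h \in unitmx -> c *m a = 1%:M -> split_torus f (torus_of (map_mx f h) a).
Proof.
move=> uh ca; have uH : map_mx f h \in unitmx by rewrite map_unitmx.
split; last by exists e; apply: torus_of_iso ca.
  split; last first.
    by exists e; rewrite -[map_mx f h]map_mx_idfun; apply: torus_of_iso ca.
  split.
  - by rewrite -[map_mx f h]map_mx_idfun; apply: torus_of_defined ca.
  - exact: torus_of_group1.
  - by move=> g g'; apply: torus_of_groupM.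
  - by move=> g; apply: torus_of_groupV.
exact: torus_of_defined ca.
Qed.

Lemma idempotent_diagonalizable (k : fieldType) n (A : 'M[k]_n) :
  A *m A = A -> diagonalizable A.
Proof.
case: n A => [|n] A AA; first by rewrite [A]flatmx0; apply: diagonalizable0.
apply/diagonalizableP; exists [:: 0; 1]; first by rewrite /= inE eq_sym oner_eq0.
rewrite !big_cons big_nil mulr1 polyC0 subr0; apply: mxminpoly_min.
rewrite rmorphM rmorphB /= horner_mx_X horner_mx_C.
by rewrite mulrBr mulr1 -[A * A]/(A *m A) AA subrr.
Qed.

Lemma laurent_eval_over (D : closedFieldType) (k : fieldType)
    (f : {rmorphism k -> D}) n (p : {mpoly k[n * n + 1]}) (h : 'M[k]_n) :
  h \in unitmx ->
  laurent f (fun w : 'rV[D]_n =>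
    eval_over f p (map_mx f h *m diag_mx w *m invmx (map_mx f h))).
Proof. exact: laurent_coords. Qed.

(** The entries are expanded with a common set of exponents. *)
Lemma laurent_mx (A : comNzRingType) (D : fieldType) (f : {rmorphism A -> D})
    r m p (F : 'rV[D]_r -> 'M[D]_(m, p)) :
  (forall i j, laurent f (fun w => F w i j)) ->
  exists (s : seq 'rV[int]_r) (C : 'rV[int]_r -> 'M[A]_(m, p)), uniq s /\
    forall w, nonvanishing w -> F w = \sum_(b <- s) mon b w *: map_mx f (C b).
Proof.
move=> FL.
have FL' (l : 'I_m * 'I_p) : exists t : seq 'rV[int]_r * ('rV[int]_r -> A),
    uniq t.1 /\ forall w, nonvanishing w ->
      F w l.1 l.2 = \sum_(b <- t.1) f (t.2 b) * mon b w.
  by have [s [c [us sE]]] := laurent_collect (FL l.1 l.2); exists (s, c).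
have [t tE] := choice FL'.
pose s := undup (flatten [seq (t l).1 | l <- enum {: 'I_m * 'I_p}]).
exists s, (fun b => \matrix_(i, j) (if b \in (t (i, j)).1 then (t (i, j)).2 b else 0)).
split=> [|w w0]; first exact: undup_uniq.
apply/matrixP => i j; have [ut ->] := tE (i, j) => //; rewrite summxE /=.
under [RHS]eq_bigr => b _ do rewrite !mxE.
rewrite [RHS](bigID (fun b => b \in (t (i, j)).1)) /= [X in _ + X]big1 ?addr0; last first.
  by move=> b /negbTE ->; rewrite rmorph0 mulr0.
rewrite [RHS](eq_bigr (fun b => f ((t (i, j)).2 b) * mon b w)); last first.
  by move=> b /= tb; rewrite tb mulrC.
rewrite -[RHS]big_filter; apply: perm_big; apply: uniq_perm => //.
  by rewrite filter_uniq ?undup_uniq.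
move=> b; rewrite mem_filter mem_undup.
have [bt|] //= := boolP (b \in _); apply/esym/flattenP.
by exists (t (i, j)).1 => //; apply/map_f; rewrite mem_enum.
Qed.

Section SplitTori.
Variables (D : closedFieldType) (k : realFieldType) (f : {rmorphism k -> D}).

(** Write [F v] as the sum of the [mon b v *: C b].  Comparing coefficients in
    [F (rowM v w) = F v *m F w], by independence of the monomials in [v] and then
    in [w], shows that the [C b] are orthogonal idempotents over [k].  In a
    basis over [k] that diagonalizes them all, the diagonal entries of [F] are
    characters. *)
Lemma laurent_hom_diagonalizable n d (F : 'rV[D]_d -> 'M[D]_n) :
  (forall i j, laurent f (fun v => F v i j)) ->
  (forall v w, nonvanishing v -> nonvanishing w -> F (rowM v w) = F v *m F w) ->
  F (const_mx 1) = 1%:M ->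
  exists (h : 'M[k]_n) (a : 'M[int]_(n, d)), h \in unitmx /\
    forall v, nonvanishing v -> F v = tor (map_mx f h) a v.
Proof.
move=> FL FM F1; have [s [A [us FE]]] := laurent_mx FL.
(* Orthogonality, from the independence of monomials in each of two factors. *)
have AM b b' : b \in s -> b' \in s -> A b *m A b' = if b == b' then A b else 0.
  move=> sb sb'; pose B b b' := A b *m A b' - (if b == b' then A b else 0).
  suff /matrixP B0 : B b b' = 0 by apply/eqP; rewrite -subr_eq0; apply/eqP/matrixP.
  apply/matrixP => i j; apply: (fmorph_inj f); rewrite [X in _ = f X]mxE rmorph0.
  have BE b1 w : b1 \in s -> nonvanishing w -> \sum_(b2 <- s) f (B b1 b2 i j) * mon b2 w = 0.
    move=> sb1 w0; apply: (mon_free (f := f) (s := s)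
      (c := fun b1 => \sum_(b2 <- s) f (B b1 b2 i j) * mon b2 w)) sb1 => // v v0.
    have fv0 := nonvanishing_map f v0; have E := FM _ _ fv0 w0.
    rewrite !FE // in E; last exact: nonvanishingM.
    have inner b3 : b3 \in s -> \sum_(b2 <- s) f (B b3 b2 i j) * mon b2 w =
        \sum_(b2 <- s) f ((A b3 *m A b2) i j) * mon b2 w - f (A b3 i j) * mon b3 w.
      move=> sb3; rewrite (eq_bigr (fun b2 => f ((A b3 *m A b2) i j) * mon b2 w -
          (if b2 == b3 then f (A b3 i j) * mon b3 w else 0))); last first.
        move=> b2 _.
        have -> : B b3 b2 i j = (A b3 *m A b2) i j - (if b3 == b2 then A b3 else 0) i j.
          by rewrite /B mxE [X in _ + X]mxE.
        rewrite rmorphB mulrBl eq_sym; congr (_ - _).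
        by case: eqVneq => [->|] //; rewrite mxE rmorph0 mul0r.
      rewrite sumrB; congr (_ - _).
      by rewrite (bigD1_seq b3) //= eqxx big1 ?addr0 // => b2 /negbTE ->.
    rewrite big_seq (eq_bigr (fun b3 => (\sum_(b2 <- s) f ((A b3 *m A b2) i j) * mon b2 w)
        * mon b3 (map_mx f v) - f (A b3 i j) * mon b3 w * mon b3 (map_mx f v))); last first.
      by move=> b3 sb3; rewrite inner // mulrBl.
    rewrite -big_seq sumrB; apply/eqP; rewrite subr_eq0; apply/eqP.
    transitivity ((\sum_(b <- s) mon b (rowM (map_mx f v) w) *: map_mx f (A b)) i j).
      rewrite E mulmx_suml summxE; apply: eq_bigr => b3 _.
      rewrite mulmx_sumr summxE mulr_suml; apply: eq_bigr => b2 _.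
      rewrite -scalemxAl -scalemxAr -map_mxM [RHS]mxE [X in _ = _ * X]mxE.
      by rewrite [X in _ = _ * (_ * X)]mxE; ring.
    rewrite summxE; apply: eq_bigr => b3 _.
    by rewrite monM mxE [X in _ * X = _]mxE; ring.
  by apply: (mon_free (f := f) (s := s) (c := fun b2 => f (B b b2 i j))) sb' => // w w0;
    apply: BE => //; apply: nonvanishing_map.
have [P uP PA] : codiagonalizable [seq A b | b <- s].
  apply/codiagonalizableP; split.
    move=> _ _ /mapP[b sb ->] /mapP[b' sb' ->]; rewrite /comm_mx !AM //.
    by rewrite eq_sym; case: eqVneq => // ->.
  move=> _ /mapP[b sb ->]; apply: idempotent_diagonalizable.
  by rewrite AM ?eqxx.
pose Q := map_mx f P; have uQ : Q \in unitmx by rewrite map_unitmx.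
pose G v := Q *m F v *m invmx Q.
have Gdiag v : nonvanishing v -> is_diag_mx (G v).
  move=> v0; rewrite /G FE // mulmx_sumr mulmx_suml; apply/is_diag_mxP => i j ij.
  rewrite summxE big_seq big1 // => b sb.
  rewrite -scalemxAr -scalemxAl mxE -map_invmx -!map_mxM mxE.
  have /allP/(_ _ (map_f A sb)) := PA; rewrite inE /= => /diagonalizable_forP -> //.
  by rewrite rmorph0 mulr0.
have GM v w : nonvanishing v -> nonvanishing w -> G (rowM v w) = G v *m G w.
  by move=> v0 w0; rewrite /G FM // !mulmxA mulmxKV.
have [a aE] : exists a : 'M[int]_(n, d),
    forall v i, nonvanishing v -> G v i i = mon (row i a) v.
  have rowE i : exists b, forall v, nonvanishing v -> G v i i = mon b v.
    apply: (@laurent_character_monomial _ _ f k f d (fun v => G v i i)).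
    - by rewrite /G /Q -map_invmx; apply: laurent_mulmx.
    - move=> v w v0 w0; rewrite GM // mxE (bigD1 i) //= big1 ?addr0 // => l li.
      by have /is_diag_mxP -> := Gdiag v v0; rewrite ?mul0r // (inj_eq val_inj) eq_sym.
    - by rewrite /G F1 mulmx1 mulmxV // mxE eqxx.
  have [b bE] := choice rowE; exists (\matrix_i b i) => v i v0.
  by rewrite rowK bE.
exists (invmx P), a; split=> [|v v0]; first by rewrite unitmx_inv.
rewrite /tor map_invmx invmxK -/Q.
have -> : diag_mx (mons a v) = G v.
  apply/matrixP => i j; rewrite [LHS]mxE [X in X *+ _]mxE.
  case: (eqVneq i j) => [<-|ij]; first by rewrite mulr1n -aE.
  rewrite mulr0n; apply/esym.
  by have /is_diag_mxP -> := Gdiag v v0; rewrite // (inj_eq val_inj).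
by rewrite /G !mulmxA mulVmx // mul1mx mulmxKV.
Qed.

(** The matrix [c] comes from [laurent_retraction]: the isomorphism onto G_m^e
    recovers the parameters as Laurent polynomials in the eigenvalues. *)
Lemma split_torusP n (T : set 'M[D]_n) : split_torus f T ->
  exists (e : nat) (h : 'M[k]_n) (a : 'M[int]_(n, e)) (c : 'M[int]_(e, n)),
    [/\ h \in unitmx, c *m a = 1%:M & T = torus_of (map_mx f h) a].
Proof.
move=> [[[[E TE] T1 TM TV] _] _
  [d [phi [psi [[[P PE] phiG phiM] [[Q QE] psiT psiM] psiK phiK]]]]].
have uT g : T g -> g \in unitmx by rewrite TE => -[].
have GmE v : nonvanishing v -> Gm_pow D d (diag_mx v) by exists v.
pose F v := psi (diag_mx v).
have FL i j : laurent f (fun v => F v i j).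
  apply: (@laurent_ext _ _ _ _ _ (fun v => eval_over f (Q i j)
      (map_mx f 1%:M *m diag_mx v *m invmx (map_mx f 1%:M)))).
    move=> v v0; rewrite /F QE; last exact: GmE.
    by rewrite mxE map_mx1 invmx1 mul1mx mulmx1.
  exact/laurent_eval_over/unitmx1.
have FM v w : nonvanishing v -> nonvanishing w -> F (rowM v w) = F v *m F w.
  by move=> v0 w0; rewrite /F diag_mx_rowM psiM //; apply: GmE.
have T_F v : nonvanishing v -> T (F v) by move=> v0; apply/psiT/GmE.
have F1 : F (const_mx 1) = 1%:M.
  have n1 := @nonvanishing1 D d; have uF := uT _ (T_F _ n1).
  have := FM _ _ n1 n1; have -> : rowM (const_mx 1) (const_mx 1) = const_mx 1 :> 'rV[D]_d.
    by apply/rowP => j; rewrite !mxE mulr1.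
  by move=> /(congr1 (mulmx (invmx (F (const_mx 1))))); rewrite mulKmx // mulVmx.
have [h [a [uh FE]]] := laurent_hom_diagonalizable FL FM F1.
have [c ca] : exists c : 'M[int]_(d, n), c *m a = 1%:M.
  apply: (@laurent_retraction _ _ f k f _ _ a (fun l w => eval_over f (P l l)
      (map_mx f h *m diag_mx w *m invmx (map_mx f h)))) => [l|v l v0].
    exact: laurent_eval_over.
  rewrite -/(tor (map_mx f h) a v) -FE //.
  have := phiK _ (GmE _ v0); rewrite -/(F v) PE; last exact: T_F.
  by move=> /matrixP/(_ l l); rewrite !mxE eqxx mulr1n.
exists d, h, a, c; split=> //; apply/seteqP; split=> [g Tg|_ [v v0 <-]].
  have [v v0 vE] := phiG g Tg; exists v => //.
  by rewrite -FE // /F vE psiK.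
by rewrite -FE //; apply: T_F.
Qed.

(** In the basis [h] the smaller torus is diagonal too, with diagonal entries that are
    characters, that is monomials with some exponents [B], and [M] is [c *m B].
    Conversely the parameters of the smaller torus are monomials in its eigenvalues,
    which are Laurent polynomials in the parameters of the larger torus, so
    [laurent_retraction] provides [N]. *)
Lemma torus_of_sub n d e (h0 h : 'M[k]_n) (b : 'M[int]_(n, d)) (c0 : 'M[int]_(d, n))
    (a : 'M[int]_(n, e)) (c : 'M[int]_(e, n)) :
  h0 \in unitmx -> h \in unitmx -> c0 *m b = 1%:M -> c *m a = 1%:M ->
  torus_of (map_mx f h0) b `<=` torus_of (map_mx f h) a ->
  exists (M : 'M[int]_(e, d)) (N : 'M[int]_(d, e)), N *m M = 1%:M /\
    forall x, nonvanishing x -> tor (map_mx f h0) b x = tor (map_mx f h) a (mons M x).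
Proof.
move=> uh0 uh c0b ca sub.
set H0 := map_mx f h0; set H := map_mx f h.
have uH0 : H0 \in unitmx by rewrite map_unitmx.
have uH : H \in unitmx by rewrite map_unitmx.
pose G x := invmx H *m tor H0 b x *m H.
have GE x : nonvanishing x -> exists2 y, nonvanishing y & tor H0 b x = tor H a y.
  by move=> x0; have [|y y0 yE] := sub (tor H0 b x); [exists x | exists y].
have laurent_conj r m (g1 g2 : 'M[k]_n) (a1 : 'M[int]_(n, r)) (M : 'M[int]_(r, m)) i j :
    laurent f (fun x : 'rV[D]_m => (invmx (map_mx f g2) *m
      tor (map_mx f g1) a1 (mons M x) *m map_mx f g2) i j).
  rewrite -map_invmx; apply: laurent_mulmx => i' j'; exact: laurent_tor_entry.
have [B BE] : exists B : 'M[int]_(n, d), forall x, nonvanishing x -> G x = diag_mx (mons B x).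
  have rowE i : exists b, forall x, nonvanishing x -> G x i i = mon b x.
    apply: (@laurent_character_monomial _ _ f k f d (fun x => G x i i)).
    - apply: laurent_ext (laurent_conj d d h0 h b 1%:M i i) => x x0.
      by rewrite mons1.
    - move=> v w v0 w0; rewrite /G torM //.
      have [y y0 ->] := GE v v0; have [z z0 ->] := GE w w0.
      by rewrite -torM // !tor_conj // monsM !mxE eqxx !mulr1n.
    - by rewrite /G tor1 // mulmx1 mulVmx // mxE eqxx.
  have [B BE] := choice rowE; exists (\matrix_i B i) => x x0.
  have [y y0 yE] := GE x x0.
  apply/matrixP => i j; rewrite [RHS]mxE; case: (eqVneq i j) => [<-|ij].
    by rewrite mulr1n BE // [RHS]mxE rowK.
  by rewrite mulr0n /G yE tor_conj // mxE (negbTE ij) mulr0n.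
exists (c *m B).
have E x : nonvanishing x -> tor H0 b x = tor H a (mons (c *m B) x).
  move=> x0; have [y y0 yE] := GE x x0; rewrite yE; congr tor.
  rewrite mons_mulmx //; have := BE x x0; rewrite /G yE tor_conj //.
  move=> /matrixP Ed; have <- : mons a y = mons B x.
    by apply/rowP => j; have := Ed j j; rewrite !mxE eqxx !mulr1n.
  by rewrite -mons_mulmx // ca mons1.
have [N NM] : exists N : 'M[int]_(d, e), N *m (c *m B) = 1%:M; last by exists N; split.
apply: (@laurent_retraction _ _ f k f _ _ (c *m B) (fun l y => \prod_j
   zpow ((invmx H0 *m tor H a y *m H0) j j)
        ((invmx H0 *m tor H a (rowV y) *m H0) j j) (c0 l j))) => [l|x l x0].
  apply: laurent_prod => j; case: (c0 l j) => m /=; apply: laurentX.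
    apply: laurent_ext (laurent_conj e e h h0 a 1%:M j j) => x x0.
    by rewrite mons1.
  apply: laurent_ext (laurent_conj e e h h0 a (- 1%:M) j j) => x x0.
  by rewrite monsN1.
have -> : x 0 l = \prod_j mons b x 0 j ^ c0 l j.
  rewrite -[in LHS](mons1 x) -c0b mons_mulmx // mxE.
  by apply: eq_bigr => j _; rewrite [row _ _ _ _]mxE.
apply: eq_bigr => j _; rewrite -monsV -!E //; last exact: nonvanishingV.
by rewrite !tor_conj // monsV !mxE eqxx !mulr1n zpowE.
Qed.

Lemma left_inverse_leq d e (M : 'M[int]_(e, d)) (N : 'M[int]_(d, e)) :
  N *m M = 1%:M -> (d <= e)%N.
Proof.
move=> /(congr1 (map_mx (intr : int -> rat))); rewrite map_mxM map_mx1 => NM.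
by have := mxrankM_maxl (map_mx (intr : int -> rat) N) (map_mx intr M);
   rewrite NM mxrank1 => /leq_trans; apply; apply: rank_leq_col.
Qed.

(** The parameters of the two tori are related by a square integer matrix with a
    one-sided inverse.  Such a matrix is invertible, so every point is reached. *)
Lemma torus_of_eq n e (h0 h : 'M[k]_n) (b a : 'M[int]_(n, e)) (c0 c : 'M[int]_(e, n)) :
  h0 \in unitmx -> h \in unitmx -> c0 *m b = 1%:M -> c *m a = 1%:M ->
  torus_of (map_mx f h0) b `<=` torus_of (map_mx f h) a ->
  torus_of (map_mx f h) a = torus_of (map_mx f h0) b.
Proof.
move=> uh0 uh c0b ca sub; apply/seteqP; split=> // _ [y y0 <-].
have [M [N [NM ME]]] := torus_of_sub uh0 uh c0b ca sub.
exists (mons N y); first exact: nonvanishing_mons.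
rewrite ME; last exact: nonvanishing_mons.
by rewrite -mons_mulmx // (mulmx1C NM) mons1.
Qed.

End SplitTori.

(** * Symmetric tori over the real numbers *)

Section RealSpectral.
Variables (k : rcfType).
Local Notation emb := (real_complex k).
Local Notation conj := (@Num.conj (complex k)).

Lemma emb_conj n m (A : 'M[k]_(n, m)) : map_mx conj (map_mx emb A) = map_mx emb A.
Proof.
apply/matrixP => i j; rewrite !mxE; apply/CrealP.
by apply/complex_realP; exists (A i j).
Qed.

Lemma emb_trmxC n m (A : 'M[k]_(n, m)) :
  map_mx conj (map_mx emb A)^T = map_mx emb A^T.
Proof. by rewrite map_trmx emb_conj. Qed.

Lemma prod_XsubC_annihilates (L : fieldType) n (U A : 'M[L]_n.+1) (d : 'rV_n.+1) (s : seq L) :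
  U \in unitmx -> A = invmx U *m diag_mx d *m U -> (forall j, d 0 j \in s) ->
  horner_mx A (\prod_(r <- s) ('X - r%:P)) = 0.
Proof.
move=> uU -> ds.
have uV : invmx U \is a GRing.unit by rewrite -[_ \is a _]/(_ \in unitmx) unitmx_inv.
rewrite -[X in _ *m _ *m X]invmxK horner_mx_uconj // horner_mx_diag.
have -> : map_mx (horner (\prod_(r <- s) ('X - r%:P))) d = 0.
  apply/rowP => j; rewrite !mxE horner_prod; apply/eqP.
  rewrite prodf_seq_eq0; apply/hasP; exists (d 0 j) => //.
  by rewrite hornerXsubC subrr eqxx.
by rewrite raddf0 mulmx0 mul0mx.
Qed.

(** By the complex spectral theorem the eigenvalues are real, and the polynomial
    that has them as simple roots annihilates the matrix. *)
Lemma symmetric_diagonalizable n (p : 'M[k]_n.+1) : p^T = p -> diagonalizable p.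
Proof.
move=> psym; pose q := map_mx emb p.
have hq : q \is hermsymmx.
  by apply/is_hermitianmxP; rewrite expr0 scale1r emb_trmxC psym.
have /mxOverP real_d := hermitian_spectral_diag_real hq.
have /orthomx_spectralP qE := hermitian_normalmx hq.
set U := spectralmx q in qE; set d := spectral_diag q in qE real_d.
have uU : U \in unitmx by apply: spectral_unit.
pose s := undup [seq complex.Re (d 0 j) | j <- enum 'I_n.+1].
have sE : forall j, d 0 j \in map emb s.
  move=> j; apply/mapP; exists (complex.Re (d 0 j)).
    by rewrite mem_undup; apply: map_f; rewrite mem_enum.
  by rewrite RRe_real.
apply/diagonalizableP; exists s; first exact: undup_uniq.
apply: mxminpoly_min; apply: (map_mx_inj (f := emb)).
rewrite map_horner_mx map_mx0 rmorph_prod -[RHS](prod_XsubC_annihilates uU qE sE).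
congr horner_mx; rewrite big_map; apply: eq_bigr => r _.
by rewrite rmorphB /= map_polyX map_polyC.
Qed.

(** A normal matrix is unitarily diagonalizable; when its eigenvalues are real it is
    then hermitian. *)
Lemma normal_diagonalizable_symmetric n (g h : 'M[k]_n.+1) (d : 'rV_n.+1) :
  h \in unitmx -> g = h *m diag_mx d *m invmx h -> g *m g^T = g^T *m g ->
  g^T = g.
Proof.
move=> uh gE gnorm; pose q := map_mx emb g.
have nq : q \is normalmx.
  by apply/normalmxP; rewrite emb_trmxC -!map_mxM gnorm.
have /orthomx_spectralP qE := nq.
set U := spectralmx q in qE; set c := spectral_diag q in qE.
have Uu : U \is unitarymx by apply: spectral_unitarymx.
have uU := unitarymx_unit Uu.
pose s := [seq d 0 j | j <- enum 'I_n.+1].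
have q0 : horner_mx q (\prod_(r <- map emb s) ('X - r%:P)) = 0.
  apply: (@prod_XsubC_annihilates _ _ (map_mx emb (invmx h)) _ (map_mx emb d)).
  - by rewrite map_unitmx unitmx_inv.
  - by rewrite -map_invmx invmxK -map_diag_mx -!map_mxM -gE.
  - by move=> j; rewrite mxE; apply/map_f/map_f; rewrite mem_enum.
have creal : map_mx conj c = c.
  apply/rowP => j; rewrite mxE; apply/CrealP/complex_realP.
  have : horner_mx (diag_mx c) (\prod_(r <- map emb s) ('X - r%:P)) = 0.
    have uV : invmx U \is a GRing.unit by rewrite -[_ \is a _]/(_ \in unitmx) unitmx_inv.
    move: q0; rewrite qE -[X in _ *m _ *m X]invmxK horner_mx_uconj //.
    move=> /(congr1 (mulmx U)); rewrite mulmx0 !mulmxA mulmxV // mul1mx invmxK.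
    by move=> /(congr1 (mulmx^~ (invmx U))); rewrite mul0mx mulmxK.
  rewrite horner_mx_diag => /matrixP/(_ j j); rewrite !mxE eqxx mulr1n horner_prod.
  move=> /eqP; rewrite prodf_seq_eq0 => /hasP[_ /mapP[x _ ->]] /=.
  by rewrite hornerXsubC subr_eq0 => /eqP ->; exists x.
have qherm : map_mx conj q^T = q.
  rewrite [in LHS]qE invmx_unitary // !trmx_mul !map_mxM tr_diag_mx map_diag_mx creal.
  by rewrite map_trmx trmxK -map_mx_comp (map_mx_id conjCK) mulmxA -invmx_unitary.
apply: (map_mx_inj (f := emb)); by rewrite -emb_trmxC.
Qed.

Lemma sum_sqr_gt0 n (v : 'cV[k]_n) : v != 0 -> 0 < (v^T *m v) 0 0.
Proof.
move=> v0; rewrite mxE lt_neqAle sumr_ge0 ?andbT; last first.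
  by move=> j _; rewrite mxE -expr2 sqr_ge0.
apply: contra v0; rewrite eq_sym psumr_eq0; last by move=> j _; rewrite mxE -expr2 sqr_ge0.
move=> /allP H; apply/eqP/colP => j; rewrite mxE; apply/eqP.
by have := H j; rewrite mem_index_enum => /(_ isT) /=; rewrite mxE -expr2 sqrf_eq0.
Qed.

(** If [v] is an eigenvector for [d 0 j], then [d 0 j] times the squared norm of
    [v] is the squared norm of [g *m v]. *)
Lemma gram_eigen_gt0 n (g P : 'M[k]_n) (d : 'rV_n) : g \in unitmx -> P \in unitmx ->
  g^T *m g = P *m diag_mx d *m invmx P -> forall j, 0 < d 0 j.
Proof.
move=> ug uP E j; pose v := col j P.
have v0 : v != 0.
  apply: contraTneq uP => v0; rewrite -unitmx_tr; apply/negP => uPT.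
  have : row j P^T = 0 by rewrite -tr_col -/v v0 trmx0.
  move=> /(congr1 (mulmx^~ (invmx P^T))); rewrite mul0mx -row_mul mulmxV // row1.
  by move=> /rowP/(_ j); rewrite !mxE !eqxx => /eqP; rewrite oner_eq0.
have gv0 : g *m v != 0 by apply: contra_neq v0 => gv0; rewrite -[v](mulKmx ug) gv0 mulmx0.
have Ev : g^T *m g *m v = d 0 j *: v.
  rewrite E /v colE -!mulmxA mulKmx // scalemxAr; congr (_ *m _).
  apply/colP => i; rewrite mul_diag_mx !mxE.
  by case: eqVneq => [->|_]; rewrite ?mulr0.
have := sum_sqr_gt0 gv0; rewrite trmx_mul -mulmxA [g^T *m _]mulmxA Ev.
by rewrite -scalemxAr mxE pmulr_lgt0 // sum_sqr_gt0.
Qed.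

Lemma mxtrace_sqr_eq0 n (A : 'M[k]_n) : \tr (A *m A^T) <= 0 -> A = 0.
Proof.
move=> le0; apply/matrixP => i j; rewrite [RHS]mxE; apply/eqP.
rewrite -sqrf_eq0 -[_ == 0](mulr1n _); apply/negPn/negP => nz.
have := le0; rewrite leNgt => /negP; apply.
rewrite /mxtrace (bigD1 i) //= ltr_pwDl //; last first.
  apply: sumr_ge0 => i' _; rewrite mxE; apply: sumr_ge0 => j' _.
  by rewrite mxE -expr2 sqr_ge0.
rewrite mxE (bigD1 j) //= ltr_pwDl //; first by rewrite mxE -expr2 lt_neqAle eq_sym nz sqr_ge0.
by apply: sumr_ge0 => j' _; rewrite mxE -expr2 sqr_ge0.
Qed.

(** Put [t := g *m invmx s *m g^T].  Both [s] and [t] have the squared norm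
    [\tr (g *m g^T)], and the right-hand side of the inequality is their scalar
    product.  The inequality thus makes the squared norm of [s - t] nonpositive, so
    [s = t], and the squares of [s] and [t] are [g^T *m g] and [g *m g^T]. *)
Lemma aluthge_trace n (g s : 'M[k]_n) : s \in unitmx -> s^T = s ->
  s *m s = g^T *m g ->
  \tr (g *m g^T) <= \tr (s *m g *m invmx s *m g^T) ->
  g *m g^T = g^T *m g.
Proof.
move=> us ssym ss le_tr; pose t := g *m invmx s *m g^T.
have vsym : (invmx s)^T = invmx s by rewrite trmx_inv ssym.
have tsym : t^T = t by rewrite /t !trmx_mul trmxK vsym mulmxA.
have tt : t *m t = g *m g^T.
  rewrite /t !mulmxA -[_ *m g^T *m g]mulmxA -ss -!mulmxA mulKmx //.
  by rewrite [s *m (invmx s *m _)]mulKVmx.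
suff st : s = t by rewrite -tt -st.
apply/eqP; rewrite -subr_eq0; apply/eqP/mxtrace_sqr_eq0.
rewrite raddfB /= ssym tsym mulmxBl !mulmxBr !raddfB /= ss tt.
rewrite [\tr (t *m s)]mxtrace_mulC [\tr (g^T *m g)]mxtrace_mulC /t !mulmxA.
lra.
Qed.

End RealSpectral.

Lemma interpolation (k : fieldType) (s : seq k) (phi : k -> k) :
  exists q : {poly k}, forall x, x \in s -> q.[x] = phi x.
Proof.
elim: s => [|x s [q qE]]; first by exists 0.
have [sx|nsx] := boolP (x \in s).
  by exists q => y; rewrite inE => /predU1P[->|]; apply: qE.
pose r := \prod_(z <- s) ('X - z%:P).
have rx : r.[x] != 0.
  rewrite horner_prod prodf_seq_neq0; apply/allP => z sz /=.
  by rewrite hornerXsubC subr_eq0; apply: contraNneq nsx => ->.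
exists (q + ((phi x - q.[x]) / r.[x])%:P * r) => y.
rewrite inE hornerD hornerM hornerC => /predU1P[->|sy].
  by rewrite divfK // addrC subrK.
rewrite qE // [r.[y]]horner_prod (big_rem y) //= hornerXsubC subrr mul0r mulr0.
by rewrite addr0.
Qed.

Definition gl_zeros (k : fieldType) n (E : {mpoly k[n * n + 1]} -> Prop) (g : 'M[k]_n) : Prop :=
  g \in unitmx /\ forall p, E p -> p.@[coords g (\det g)^-1] = 0.

(** On the diagonal matrices in the basis [P], a polynomial is a sum of terms
    [x_b * mon b d].  If the sum of the [x_b * (mon b d) ^+ m] vanishes for all [m],
    then so does the sum of the [x_b * q.[mon b d]] for any polynomial [q], and
    [q] can be chosen to take the square root at all the numbers [mon b d]. *)
Lemma gl_zeros_sqrt (k : rcfType) n (E : {mpoly k[n * n + 1]} -> Prop)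
    (P : 'M[k]_n) (d c : 'rV[k]_n) : P \in unitmx ->
  (forall j, 0 < c 0 j) -> (forall j, d 0 j = c 0 j ^+ 2) ->
  (forall m, gl_zeros E (P *m diag_mx (map_mx (fun x => x ^+ m) d) *m invmx P)) ->
  gl_zeros E (P *m diag_mx c *m invmx P).
Proof.
move=> uP c0 dE Ed.
have nzc : nonvanishing c by move=> j; rewrite gt_eqF.
have nzd m : nonvanishing (map_mx (fun x => x ^+ m) d).
  by move=> j; rewrite mxE dE -exprM expf_neq0 // gt_eqF.
split=> [|p Ep]; first by rewrite !unitmx_mul unitmx_inv uP unit_diag_mx.
have [s sE] := laurent_coords (idfun : {rmorphism k -> k}) p uP.
have sE' w : nonvanishing w -> p.@[coords (P *m diag_mx w *m invmx P)
    (\det (P *m diag_mx w *m invmx P))^-1] = \sum_(t <- s) t.1 * mon t.2 w.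
  move=> w0; have /= := sE w w0; rewrite meval_map_id //.
  by have -> : map_mx idfun P = P by apply/matrixP => i j; rewrite mxE.
have mon_gt0 b : 0 < mon b c.
  by rewrite /mon; apply: prodr_gt0 => j _; rewrite exprz_gt0.
have monE b : mon b d = mon b c ^+ 2.
  rewrite /mon -prodrXl; apply: eq_bigr => j _.
  by rewrite dE !exprnP exprzAC.
have monX b m : mon b (map_mx (fun x => x ^+ m) d) = mon b d ^+ m.
  rewrite /mon -prodrXl; apply: eq_bigr => j _.
  by rewrite mxE !exprnP exprzAC.
have [q qE] := interpolation [seq mon t.2 d | t <- s] Num.sqrt.
rewrite sE' // (eq_big_seq (fun t => t.1 * q.[mon t.2 d])) => [|t st]; last first.
  rewrite qE; last by apply/mapP; exists t.
  by rewrite monE sqrtr_sqr gtr0_norm.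
under eq_bigr => t _ do rewrite horner_coef mulr_sumr.
rewrite exchange_big big1 //= => i _.
under eq_bigr => t _ do rewrite mulrCA -monX.
by rewrite -mulr_sumr -sE' // (Ed i).2 // mulr0.
Qed.

Lemma trmx_horner (k : comNzRingType) n (A : 'M[k]_n.+1) (q : {poly k}) :
  (horner_mx A q)^T = horner_mx A^T q.
Proof.
elim/poly_ind: q => [|q c IHq]; first by rewrite !rmorph0 trmx0.
rewrite !rmorphD !rmorphM /= !horner_mx_X !horner_mx_C raddfD /= tr_scalar_mx.
congr (_ + _); rewrite -[_ * A]/(_ *m A) trmx_mul IHq.
by rewrite -[RHS]/(_ *m A^T); apply: comm_mx_horner.
Qed.

(** The vector consists of the powers of an integer that is not a root of any of
    the polynomials with coefficients [b - c]. *)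
Lemma exists_separating_vector r (s : seq 'rV[int]_r) :
  exists w : 'cV[int]_r, forall b c, b \in s -> c \in s ->
    (b *m w) 0 0 = (c *m w) 0 0 -> b = c.
Proof.
pose P : {poly int} := \prod_(b <- s) \prod_(c <- s) (if b == c then 1 else rVpoly (b - c)).
have P0 : P != 0.
  rewrite prodf_seq_neq0; apply/allP => b _; rewrite prodf_seq_neq0.
  apply/allP => c _ /=; case: (eqVneq b c) => [_|bc]; first exact: oner_neq0.
  by rewrite raddf_eq0 ?subr_eq0 //; apply: can_inj rVpolyK.
have [x Px] : exists x, P.[x] != 0.
  pose rs := [seq (j : nat)%:Z | j <- iota 0 (size P)].
  have [/hasP[x _ Px]|/hasPn no] := boolP (has (fun x => P.[x] != 0) rs).
    by exists x.
  have : (size rs < size P)%N.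
    apply: max_poly_roots => //; last by rewrite map_inj_uniq ?iota_uniq // => i j [].
    by apply/allP => x /no; rewrite negbK.
  by rewrite size_map size_iota ltnn.
exists (\col_l x ^+ l) => b c sb sc E.
have [//|bc] := eqVneq b c.
move: Px; rewrite horner_prod prodf_seq_neq0 => /allP/(_ b sb) /=.
rewrite horner_prod prodf_seq_neq0 => /allP/(_ c sc) /=.
rewrite (negbTE bc) => /negP[]; apply/eqP.
have <- : ((b - c) *m (\col_l x ^+ l)) 0 0 = (rVpoly (b - c)).[x].
  rewrite mxE (@horner_coef_wide _ r); last exact: size_poly.
  by apply: eq_bigr => l _; rewrite coef_rVpoly_ord [X in _ * X = _]mxE.
by rewrite mulmxBl mxE [X in _ + X]mxE E subrr.
Qed.

Lemma invmx_mul (k : fieldType) n (A B : 'M[k]_n) : A \in unitmx -> B \in unitmx ->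
  invmx (A *m B) = invmx B *m invmx A.
Proof.
move=> uA uB; have uAB : A *m B \in unitmx by rewrite unitmx_mul uA.
by rewrite -[RHS](mulKmx uAB) !mulmxA !mulmxK.
Qed.

Lemma char_poly_conj (k : fieldType) n (h A : 'M[k]_n) : h \in unitmx ->
  char_poly (h *m A *m invmx h) = char_poly A.
Proof.
move=> uh; pose H := map_mx polyC h; pose H' := map_mx polyC (invmx h).
have HH' : H *m H' = 1%:M by rewrite -map_mxM mulmxV // map_mx1.
rewrite /char_poly; have -> : char_poly_mx (h *m A *m invmx h) = H *m char_poly_mx A *m H'.
  rewrite /char_poly_mx !map_mxM mulmxBr mulmxBl; congr (_ - _).
  by rewrite scalar_mxC -mulmxA HH' mulmx1.
by rewrite !det_mulmx mulrAC -det_mulmx HH' det1 mul1r.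
Qed.

Lemma diag_char_poly_similar (k : fieldType) n (d m : 'rV[k]_n) :
  char_poly (diag_mx d) = char_poly (diag_mx m) ->
  exists2 S, S \in unitmx & diag_mx d = S *m diag_mx m *m invmx S.
Proof.
rewrite !char_poly_trig ?diag_mx_is_trig // => E.
pose codiag (c : 'rV[k]_n) := [tuple c 0 j | j < n].
have prodE c : \prod_(i < n) ('X - (diag_mx c i i)%:P) = \prod_(x <- codiag c) ('X - x%:P).
  by rewrite big_map big_enum; apply: eq_bigr => i _; rewrite mxE eqxx mulr1n.
move: E; rewrite !prodE => /prod_XsubC_eq /tuple_permP[s sE].
have dE j : d 0 j = m 0 (s j).
  have /(congr1 (fun t => nth 0 t j)) := sE.
  by rewrite -!tnth_nth !tnth_mktuple.
exists (perm_mx s); first exact: unitmx_perm.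
have -> : invmx (perm_mx s) = perm_mx s^-1 :> 'M[k]_n.
  rewrite -[RHS](mulKmx (unitmx_perm _ s)) -perm_mxM.
  by rewrite mulgV perm_mx1 mulmx1.
rewrite -row_permE -col_permE; apply/matrixP => i j.
by rewrite !mxE dE (inj_eq perm_inj).
Qed.

Lemma sqnorm_mxvec (R : realType) n (g : 'M[R]_n) :
  MinimalVector.sqnorm (mxvec g) = \tr (g *m g^T).
Proof.
rewrite /MinimalVector.sqnorm (reindex _ (curry_mxvec_bij _ _)) /=.
rewrite (eq_bigr (fun p => mxvec g 0 (mxvec_index p.1 p.2) ^+ 2)); last by case.
rewrite -(pair_bigA _ (fun i j => mxvec g 0 (mxvec_index i j) ^+ 2)) /=.
apply: eq_bigr => i _; rewrite mxE; apply: eq_bigr => j _.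
by rewrite mxvecE mxE expr2.
Qed.

Section ConjugateDiagonal.
Variables (k : fieldType) (n e : nat) (E : {mpoly k[n.+1 * n.+1 + 1]} -> Prop).
Variables (a : 'M[int]_(n.+1, e)) (t : 'rV[k]_e).
Hypothesis t0 : nonvanishing t.
Hypothesis t_sep : forall i j, mons a t 0 i = mons a t 0 j -> row i a = row j a.
Local Notation mu := (mons a t).
Local Notation N := (n.+1 * n.+1)%N.

(** The eigenvalues at [t] separate the weights, so all points of the torus are
    polynomials in the single matrix [tor h a t], and these polynomials do not
    depend on [h]. *)
Lemma tor_interpolation : exists q : 'rV[k]_e -> {poly k},
  forall h y, h \in unitmx -> tor h a y = horner_mx (tor h a t) (q y).
Proof.
have qE y : exists q : {poly k}, forall j, q.[mu 0 j] = mons a y 0 j.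
  pose phi x := if [pick j | mu 0 j == x] is Some j then mons a y 0 j else 0.
  have [q qE] := interpolation [seq mu 0 j | j <- enum 'I_n.+1] phi.
  exists q => j; rewrite qE ?map_f ?mem_enum // /phi.
  case: pickP => [i /eqP/t_sep rE|/(_ j)]; last by rewrite eqxx.
  by rewrite ![mons a y _ _]mxE rE.
have [q qE'] := choice qE; exists q => h y uh.
rewrite /tor horner_mx_uconj // horner_mx_diag; congr (_ *m diag_mx _ *m _).
by apply/rowP => j; rewrite mxE [RHS]mxE qE' mxE.
Qed.

(** The values at [t] of the tori with weights [a] that lie in the group. *)
Definition diag_conjugate (g : 'M[k]_n.+1) : Prop := exists h, [/\ h \in unitmx,
  g = tor h a t & forall y, nonvanishing y -> gl_zeros E (tor h a y)].

(** The equations say that a polynomial with simple roots annihilates the matrix,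
    that its characteristic polynomial is the right one, and that the interpolated
    points of the torus satisfy [E].  The first two conditions make the
    matrix conjugate to the diagonal matrix of the monomials at [t]. *)
Lemma diag_conjugate_algebraic : exists Q : {mpoly k[N]} -> Prop,
  forall v : 'rV[k]_N, diag_conjugate (vec_mx v) <->
    forall q, Q q -> q.@[fun l => v 0 l] = 0.
Proof.
have [q qE] := tor_interpolation.
pose X : 'M[{mpoly k[N]}]_n.+1 := \matrix_(i, j) 'X_(mxvec_index i j).
pose ev (v : 'rV[k]_N) : {rmorphism {mpoly k[N]} -> k} := meval (fun l => v 0 l).
pose C : {rmorphism k -> {mpoly k[N]}} := @mpolyC N k.
have evC v c : ev v (C c) = c by apply: mevalC.
have evX v : map_mx (ev v) X = vec_mx v.
  by apply/matrixP => i j; rewrite !mxE; apply: mevalXU.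
have evH v p : map_mx (ev v) (horner_mx X (map_poly C p)) = horner_mx (vec_mx v) p.
  rewrite map_horner_mx evX -map_poly_comp; congr horner_mx.
  by rewrite map_poly_id // => c _; apply: evC.
pose rs := undup [seq mu 0 j | j <- enum 'I_n.+1].
pose m := \prod_(r <- rs) ('X - r%:P).
pose D0 := diag_mx mu.
pose dt (y : 'rV[k]_e) : k := (\prod_j mons a y 0 j)^-1.
pose Q1 (p : {mpoly k[N]}) := exists i j, p = horner_mx X (map_poly C m) i j.
pose Q2 (p : {mpoly k[N]}) := exists i, p = (char_poly X)`_i - C (char_poly D0)`_i.
pose Q3 (p : {mpoly k[N]}) := exists r y, [/\ E r, nonvanishing y & p =
  (map_mpoly C r).@[coords (horner_mx X (map_poly C (q y))) (C (dt y))]].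
exists (fun p : {mpoly k[N]} => [\/ Q1 p, Q2 p | Q3 p]) => v.
have ev3 r y : ev v (map_mpoly C r).@[coords (horner_mx X (map_poly C (q y))) (C (dt y))]
    = r.@[coords (horner_mx (vec_mx v) (q y)) (dt y)].
  rewrite rmorph_meval_map -(meval_map_id r (f := idfun)) //.
  apply: eq_meval_map => [c|l] /=; first exact: evC.
  by rewrite coords_map evH evC.
have ev1 i j : ev v (horner_mx X (map_poly C m) i j) = horner_mx (vec_mx v) m i j.
  by rewrite -evH [RHS]mxE.
have ev2 i : ev v ((char_poly X)`_i - C (char_poly D0)`_i) =
    (char_poly (vec_mx v))`_i - (char_poly D0)`_i.
  by rewrite rmorphB -coef_map evC map_char_poly evX.
have mu_rs j : mu 0 j \in rs by rewrite mem_undup map_f ?mem_enum.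
split.
  move=> [h [uh gE hE]] p [[i [j ->]]|[i ->]|[r [y [Er y0 ->]]]].
  - rewrite -[LHS]/(ev v _) ev1.
    rewrite (@prod_XsubC_annihilates _ _ (invmx h) _ mu) ?mxE ?unitmx_inv //.
    by rewrite invmxK.
  - by rewrite -[LHS]/(ev v _) ev2 gE char_poly_conj // subrr.
  - rewrite -[LHS]/(ev v _) ev3 gE -qE // /dt -(det_tor a y uh).
    exact: (hE y y0).2.
move=> Qv; set g := vec_mx v in ev1 ev2 ev3 *.
have gm : horner_mx g m = 0.
  apply/matrixP => i j; rewrite [RHS]mxE -ev1; apply: Qv.
  by constructor 1; exists i, j.
have gchar : char_poly g = char_poly D0.
  apply/polyP => i; apply/eqP; rewrite -subr_eq0 -ev2; apply/eqP/Qv.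
  by constructor 2; exists i.
have [P uP /(diagonalizable_forLR uP)[d]] : diagonalizable g.
  apply/diagonalizableP; exists rs; first exact: undup_uniq.
  exact: mxminpoly_min.
rewrite mxpoly.conjumx ?unitmx_inv // invmxK => gE.
have uP' : invmx P \in unitmx by rewrite unitmx_inv.
have gE' : g = invmx P *m diag_mx d *m invmx (invmx P) by rewrite invmxK.
have [S uS dE] : exists2 S, S \in unitmx & diag_mx d = S *m diag_mx mu *m invmx S.
  by apply: diag_char_poly_similar; rewrite -gchar gE' char_poly_conj.
pose h := invmx P *m S; have uh : h \in unitmx by rewrite unitmx_mul uP'.
have gtor : g = tor h a t by rewrite gE' dE /tor /h invmx_mul // !mulmxA.
exists h; split=> // y y0; split=> [|r Er]; first exact: unit_tor.
rewrite det_tor // qE // -gtor -[LHS]ev3; apply: Qv.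
by constructor 3; exists r, y.
Qed.

End ConjugateDiagonal.

(** Among the values at a separating point [t] of the tori in the group with
    weights [a], one has the least norm.  Conjugation by elements of the group
    permutes these values, so the Aluthge transform of the minimal one is not
    shorter, which forces it to be normal, hence symmetric. *)
Lemma symmetric_torus (R : realType) n e (E : {mpoly R[n * n + 1]} -> Prop)
    (a : 'M[int]_(n, e)) (h0 : 'M[R]_n) :
  gl_zeros E 1%:M ->
  (forall g g', gl_zeros E g -> gl_zeros E g' -> gl_zeros E (g *m g')) ->
  (forall g, gl_zeros E g -> gl_zeros E (invmx g)) ->
  (forall g, gl_zeros E g -> gl_zeros E g^T) ->
  h0 \in unitmx -> (forall y, nonvanishing y -> gl_zeros E (tor h0 a y)) ->
  exists2 h, h \in unitmx &
    forall y, nonvanishing y -> gl_zeros E (tor h a y) /\ (tor h a y)^T = tor h a y.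
Proof.
case: n => [|n] in E a h0 *.
  (* Polynomials are evaluated only at matrices of positive size. *)
  move=> _ _ _ _ uh0 h0E; exists h0 => // y y0; split; first exact: h0E.
  by apply/matrixP => -[].
move=> E1 EM EV ET uh0 h0E.
have [w wE] := exists_separating_vector [seq row i a | i <- enum 'I_n.+1].
(* A positive point whose monomials with exponents the rows of [a] are distinct
   powers of 2 for distinct rows. *)
pose t : 'rV[R]_e := \row_l 2 ^ w l 0.
have t_gt0 l : 0 < t 0 l by rewrite mxE exprz_gt0.
have t0 : nonvanishing t by move=> l; rewrite gt_eqF.
have mon_t b : mon b t = 2 ^ (b *m w) 0 0.
  rewrite mxE /mon (big_morph (fun x => 2 ^ x) (op1 := *%R) (id1 := 1)) //; last first.
    by move=> x y; rewrite expfzDr // pnatr_eq0.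
  by apply: eq_bigr => l _; rewrite mxE -exprz_exp exprzAC.
have t_sep i j : mons a t 0 i = mons a t 0 j -> row i a = row j a.
  rewrite [mons a t 0 i]mxE [mons a t 0 j]mxE !mon_t => E2.
  have rowE l : row l a \in [seq row i a | i <- enum 'I_n.+1].
    by apply/mapP; exists l; rewrite ?mem_enum.
  by apply: wE (rowE i) (rowE j) (ieexprIz _ _ E2); rewrite ?ltr0n // pnatr_eq1.
have mu_gt0 j : 0 < mons a t 0 j by rewrite mxE mon_t exprz_gt0.
have [q qE] := tor_interpolation t_sep.
have [Q QE] := diag_conjugate_algebraic E t_sep.
have [|v /QE[h [uh gE hE]] vmin] := @MinimalVector.exists_min_sqnorm R _ Q.
  exists (mxvec (tor h0 a t)); apply/QE; rewrite mxvecK.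
  by exists h0; split.
set g := vec_mx v in gE.
have minE h' : h' \in unitmx -> (forall y, nonvanishing y -> gl_zeros E (tor h' a y)) ->
    \tr (g *m g^T) <= \tr (tor h' a t *m (tor h' a t)^T).
  move=> uh' h'E; rewrite -!sqnorm_mxvec vec_mxK; apply: vmin.
  by apply/QE; rewrite mxvecK; exists h'; split.
have Eg : gl_zeros E g by rewrite gE; apply: hE.
have ug := Eg.1; have ugT : g^T \in unitmx by rewrite unitmx_tr.
have sqrtP (p P : 'M[R]_n.+1) (d : 'rV_n.+1) : P \in unitmx -> (forall j, 0 < d 0 j) ->
    p = P *m diag_mx d *m invmx P -> p^T = p -> gl_zeros E p ->
    exists (b : 'M[R]_n.+1) (c : 'rV_n.+1), [/\ (forall j, 0 < c 0 j),
      b = P *m diag_mx c *m invmx P, b^T = b, b *m b = p & gl_zeros E b].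
  move=> uP d0 pE psym Ep; pose c : 'rV[R]_n.+1 := \row_j Num.sqrt (d 0 j).
  have c0 j : 0 < c 0 j by rewrite mxE sqrtr_gt0.
  have dE j : d 0 j = c 0 j ^+ 2 by rewrite mxE sqr_sqrtr // ltW.
  have [r rE] := interpolation [seq d 0 j | j <- enum 'I_n.+1] Num.sqrt.
  have bE : P *m diag_mx c *m invmx P = horner_mx p r.
    rewrite pE horner_mx_uconj // horner_mx_diag; congr (_ *m diag_mx _ *m _).
    by apply/rowP => j; rewrite !mxE rE // map_f ?mem_enum.
  exists (P *m diag_mx c *m invmx P), c; split=> //.
  - by rewrite bE trmx_horner psym.
  - rewrite !mulmxA mulmxKV // -[P *m _ *m diag_mx c]mulmxA mulmx_diag pE.
    by congr (_ *m diag_mx _ *m _); apply/rowP => j; rewrite mxE dE.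
  - apply: (@gl_zeros_sqrt _ _ E P d c) => // m.
    elim: m => [|m IHm].
      have -> : map_mx (fun x => x ^+ 0) d = const_mx 1.
        by apply/rowP => j; rewrite !mxE expr0.
      by rewrite diag_const_mx mulmx1 mulmxV.
    have -> : diag_mx (map_mx (fun x => x ^+ m.+1) d) =
        diag_mx d *m diag_mx (map_mx (fun x => x ^+ m) d).
      rewrite mulmx_diag; congr diag_mx; apply/rowP => j.
      by rewrite !mxE exprS.
    have := EM _ _ Ep IHm; rewrite pE !mulmxA mulmxKV //.
have psym : (g^T *m g)^T = g^T *m g by rewrite trmx_mul trmxK.
have [P uP /(diagonalizable_forLR uP)[d]] := symmetric_diagonalizable psym.
rewrite mxpoly.conjumx ?unitmx_inv // => pE.
have uP' : invmx P \in unitmx by rewrite unitmx_inv.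
have d0 := gram_eigen_gt0 ug uP' pE.
have [s [c [c0 sE ssym ss Es]]] := sqrtP _ _ _ uP' d0 pE psym (EM _ _ (ET _ Eg) Eg).
have [b [c' [_ _ bsym bb Eb]]] := sqrtP _ _ _ uP' c0 sE ssym Es.
have ub := Eb.1; have us := Es.1.
(* [s] and [b] are the square root and the fourth root of [g^T *m g]; conjugation
   by [b] is the Aluthge transform. *)
have gnorm : g *m g^T = g^T *m g.
  apply: aluthge_trace us ssym ss _.
  have torb y : tor (b *m h) a y = b *m tor h a y *m invmx b.
    by rewrite /tor invmx_mul // !mulmxA.
  have ubh : b *m h \in unitmx by rewrite unitmx_mul ub.
  have := minE _ ubh; rewrite torb -gE => /(_ _)/le_trans; apply.
    by move=> y y0; rewrite torb; apply: (EM _ _ _ (EV _ Eb)); apply: (EM _ _ Eb); apply: hE.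
  rewrite !trmx_mul trmx_inv bsym !mulmxA -[_ *m invmx b *m invmx b]mulmxA.
  by rewrite -invmx_mul // bb mxtrace_mulC !mulmxA bb.
have gsym := normal_diagonalizable_symmetric uh gE gnorm.
exists h => // y y0; split; first exact: hE.
by rewrite qE // trmx_horner -gE gsym.
Qed.

(** * Maximal split tori *)

Lemma factor_embedding (K F D : fieldType) (iK : {rmorphism K -> D}) (iF : {rmorphism F -> D}) :
  range iK `<=` range iF -> exists i : {rmorphism K -> F}, forall x, iF (i x) = iK x.
Proof.
move=> sub; have [g gE] : exists g : K -> F, forall x, iF (g x) = iK x.
  have H x : exists y, iF y = iK x by have [|y _ yE] := sub (iK x); [exists x | exists y].
  by have [g gE] := choice H; exists g.
have gA : zmod_morphism g.
  by move=> x y; apply: (fmorph_inj iF); rewrite rmorphB !gE rmorphB.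
have gM : monoid_morphism g.
  by split=> [|x y]; apply: (fmorph_inj iF); rewrite ?rmorphM !gE ?rmorph1 ?rmorphM.
pose gA' := GRing.isZmodMorphism.Build K F g gA.
pose gM' := GRing.isMonoidMorphism.Build K F g gM.
pose r : {rmorphism K -> F} := HB.pack g gA' gM'.
by exists r.
Qed.

Section TransferTorus.
Variables (K k : rcfType) (i : {rmorphism K -> k}) (n e : nat) (a : 'M[int]_(n, e)).
Variable J : 'rV[K]_e -> {mpoly K[n * n + 1]} -> Prop.

Local Notation N := (n * n + n * n)%N.

(** The unknowns are the entries of [h] and those of its inverse.  The determinant
    of [tor h a y] does not depend on [h], so each condition at a point [y] with
    coordinates in [K] is a polynomial equation over [K] in these unknowns. *)
Lemma transfer_tor (h : 'M[k]_n) : h \in unitmx ->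
  (forall y p, nonvanishing y -> J y p ->
     (map_mpoly i p).@[coords (tor h a (map_mx i y)) (\det (tor h a (map_mx i y)))^-1] = 0) ->
  exists2 hK : 'M[K]_n, hK \in unitmx & forall y p, nonvanishing y -> J y p ->
     p.@[coords (tor hK a y) (\det (tor hK a y))^-1] = 0.
Proof.
move=> uh hJ.
pose C : {rmorphism K -> {mpoly K[N]}} := @mpolyC N K.
pose X : 'M[{mpoly K[N]}]_n := \matrix_(i, j) 'X_(lshift _ (mxvec_index i j)).
pose X' : 'M[{mpoly K[N]}]_n := \matrix_(i, j) 'X_(rshift _ (mxvec_index i j)).
pose Xtor y := X *m map_mx C (diag_mx (mons a y)) *m X'.
pose dt (y : 'rV[K]_e) := (\prod_j mons a y 0 j)^-1.
pose Q (q : {mpoly K[N]}) := (exists i j, q = (X *m X' - 1%:M) i j) \/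
  (exists y p, [/\ nonvanishing y, J y p & q = (map_mpoly C p).@[coords (Xtor y) (C (dt y))]]).
pose pt (L : fieldType) (A A' : 'M[L]_n) : 'I_N -> L := row_mx (mxvec A) (mxvec A') 0.
pose ev (L : fieldType) (f : {rmorphism K -> L}) (A A' : 'M[L]_n) :
  {rmorphism {mpoly K[N]} -> L} := meval (pt L A A') \o map_mpoly f.
have evalE (L : fieldType) (f : {rmorphism K -> L}) (A A' : 'M[L]_n) (phi := ev L f A A') :
    [/\ map_mx phi X = A, map_mx phi X' = A' & forall c, phi (C c) = f c].
  split=> [||c]; last by rewrite /phi /= map_mpolyC mevalC.
    apply/matrixP => i1 i2; rewrite !mxE /phi /= map_mpolyX mevalXU.
    by rewrite /pt row_mxEl mxvecE.
  apply/matrixP => i1 i2; rewrite !mxE /phi /= map_mpolyX mevalXU.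
  by rewrite /pt row_mxEr mxvecE.
have evalP (L : fieldType) (f : {rmorphism K -> L}) (A A' : 'M[L]_n) y p :
    (map_mpoly f (map_mpoly C p).@[coords (Xtor y) (C (dt y))]).@[pt L A A'] =
    (map_mpoly f p).@[coords (A *m diag_mx (mons a (map_mx f y)) *m A') (f (dt y))].
  have [EX EX' EC] := evalE L f A A'.
  rewrite -[LHS]/(ev L f A A' _) rmorph_meval_map; apply: eq_meval_map => [c|l].
    exact: EC.
  rewrite -[LHS]/(ev L f A A' (coords (Xtor y) (C (dt y)) l)) coords_map EC; congr (coords _ _ _).
  rewrite !map_mxM EX EX' -map_mx_comp; congr (_ *m _ *m _).
  by rewrite map_mons -map_diag_mx; apply: eq_map_mx => c; apply: EC.
have evalU (L : fieldType) (f : {rmorphism K -> L}) (A A' : 'M[L]_n) i1 i2 :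
    (map_mpoly f ((X *m X' - 1%:M) i1 i2)).@[pt L A A'] = (A *m A' - 1%:M) i1 i2.
  have [EX EX' EC] := evalE L f A A'.
  have AA' : A *m A' = map_mx (ev L f A A') (X *m X') by rewrite map_mxM EX EX'.
  rewrite -[LHS]/(ev L f A A' _) [in RHS]AA'.
  by rewrite -(map_mx1 (ev L f A A')) -map_mxB [RHS]mxE.
(* The determinant of a point of the torus depends on its parameter only. *)
have dtE (L : fieldType) (f : {rmorphism K -> L}) (A : 'M[L]_n) y : A \in unitmx ->
    f (dt y) = (\det (tor A a (map_mx f y)))^-1.
  move=> uA; rewrite det_tor // fmorphV rmorph_prod map_mons; congr _^-1.
  by apply: eq_bigr => j _; rewrite [RHS]mxE.
have [v vQ] : exists v, forall q, Q q -> q.@[v] = 0.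
  apply: (@transfer_zero _ _ i _ _ (pt k h (invmx h))) => q [[i1 [i2 ->]]|[y [p [y0 Jp ->]]]].
    by rewrite evalU mulmxV // subrr mxE.
  by rewrite evalP -/(tor h a _) (dtE _ _ _ _ uh); apply: hJ.
pose A : 'M[K]_n := \matrix_(i, j) v (lshift _ (mxvec_index i j)).
pose A' : 'M[K]_n := \matrix_(i, j) v (rshift _ (mxvec_index i j)).
have ptE : pt K A A' =1 v.
  move=> l; rewrite /pt; case: (split_ordP l) => [l' ->|l' ->].
    by case/mxvec_indexP: l' => i1 i2; rewrite row_mxEl mxvecE mxE.
  by case/mxvec_indexP: l' => i1 i2; rewrite row_mxEr mxvecE mxE.
have vE q : (map_mpoly (idfun : {rmorphism K -> K}) q).@[pt K A A'] = q.@[v].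
  by rewrite meval_map_id //; apply: meval_eq.
have AA' : A *m A' = 1%:M.
  apply/matrixP => i1 i2; apply/eqP; rewrite -subr_eq0; apply/eqP.
  have := evalU K idfun A A' i1 i2; rewrite vE vQ; last by left; exists i1, i2.
  by rewrite !mxE => <-.
have [uA _] := mulmx1_unit AA'.
have A'E : A' = invmx A by rewrite -[A'](mulKmx uA) AA' mulmx1.
exists A => // y p y0 Jp.
have yE : map_mx idfun y = y by apply/rowP => j; rewrite mxE.
have := evalP K idfun A A' y p; rewrite vE vQ; last by right; exists y, p.
rewrite meval_map_id // A'E -/(tor A a _) (dtE _ _ _ _ uA) yE => <-.
by [].
Qed.

End TransferTorus.

Section GroupPoints.
Variables (D : closedFieldType) (K : rcfType) (iK : {rmorphism K -> D}) (n : nat).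

Lemma eval_over_map (k : fieldType) (i : {rmorphism K -> k}) (f : {rmorphism k -> D})
    (p : {mpoly K[n * n + 1]}) (g : 'M[k]_n) : (forall x, f (i x) = iK x) ->
  eval_over iK p (map_mx f g) = f (map_mpoly i p).@[coords g (\det g)^-1].
Proof.
move=> fi; rewrite rmorph_meval_map; apply: eq_meval_map => [c|l] //=.
by rewrite coords_map fmorphV -det_map_mx.
Qed.

Lemma eval_over_rational (p : {mpoly K[n * n + 1]}) (g : 'M[K]_n) :
  eval_over iK p (map_mx iK g) = iK p.@[coords g (\det g)^-1].
Proof.
by rewrite (@eval_over_map _ (idfun : {rmorphism K -> K}) iK) // meval_map_id.
Qed.

Lemma tor_entries_dense e d (h h' : 'M[K]_n) (a : 'M[int]_(n, e)) (M : 'M[int]_(e, d))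
    e' (a' : 'M[int]_(n, e')) (M' : 'M[int]_(e', d)) i j i' j' :
  (forall v, nonvanishing v -> tor h a (mons M v) i j = tor h' a' (mons M' v) i' j') ->
  forall x, nonvanishing x -> tor (map_mx iK h) a (mons M x) i j =
    tor (map_mx iK h') a' (mons M' x) i' j'.
Proof.
move=> E x x0; apply/eqP; rewrite -subr_eq0; apply/eqP; move: x x0.
apply: (@laurent_dense K D iK _ iK d (fun x => tor (map_mx iK h) a (mons M x) i j -
    tor (map_mx iK h') a' (mons M' x) i' j')) => [|v v0].
  apply: (@laurent_ext _ _ _ _ _ (fun x => tor (map_mx iK h) a (mons M x) i j +
    iK (-1) * tor (map_mx iK h') a' (mons M' x) i' j')).
    by move=> x x0; rewrite rmorphN1 mulN1r.
  apply: laurentD; first exact: laurent_tor_entry.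
  by apply: laurentM; [apply: laurent_const | apply: laurent_tor_entry].
rewrite !map_mons -!map_tor [X in X - _]mxE [X in _ - X]mxE E //.
exact: subrr.
Qed.

Variables (G : set 'M[D]_n) (E : set {mpoly K[n * n + 1]}).
Hypothesis GE : G = [set g | g \in unitmx /\ forall p, E p -> eval_over iK p g = 0].

Lemma torus_of_rational_sub e (a : 'M[int]_(n, e)) (h : 'M[K]_n) : h \in unitmx ->
  (forall y p, nonvanishing y -> E p ->
     p.@[coords (tor h a y) (\det (tor h a y))^-1] = 0) ->
  torus_of (map_mx iK h) a `<=` G.
Proof.
move=> uh hE _ [y y0 <-]; rewrite GE; split.
  by apply: unit_tor => //; rewrite map_unitmx.
move=> p Ep; move: y y0.
apply: (@laurent_dense K D iK _ iK e (fun y => eval_over iK p (tor (map_mx iK h) a y))).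
  exact: laurent_mons (laurent_coords iK p uh).
move=> v v0; rewrite -map_tor eval_over_rational hE //.
exact: rmorph0.
Qed.

Lemma gl_zeros_group (k : fieldType) (i : {rmorphism K -> k}) (f : {rmorphism k -> D})
    (g : 'M[k]_n) : (forall x, f (i x) = iK x) ->
  gl_zeros [set map_mpoly i p | p in E] g <-> G (map_mx f g).
Proof.
move=> fi; rewrite GE /gl_zeros /= map_unitmx; split=> -[ug Eg]; split=> // p.
  move=> Ep; rewrite (eval_over_map _ _ fi) Eg ?rmorph0 //.
  by exists p.
move=> [q Eq <-]; apply: (fmorph_inj f).
by rewrite -(eval_over_map _ _ fi) Eg // rmorph0.
Qed.

Lemma vanish_on_torus (k : fieldType) (i : {rmorphism K -> k})
    (f : {rmorphism k -> D}) e (a : 'M[int]_(n, e)) h y p :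
  (forall x, f (i x) = iK x) -> torus_of (map_mx f h) a `<=` G ->
  nonvanishing y -> E p ->
  (map_mpoly i p).@[coords (tor h a y) (\det (tor h a y))^-1] = 0.
Proof.
move=> fi sG y0 Ep; apply: (fmorph_inj f).
rewrite rmorph0 -(eval_over_map _ _ fi) map_tor.
have : G (tor (map_mx f h) a (map_mx f y)).
  by apply: sG; exists (map_mx f y) => //; apply: nonvanishing_map.
by rewrite GE => -[_]; apply.
Qed.

Lemma torus_descends (k : rcfType) (i : {rmorphism K -> k})
    (f : {rmorphism k -> D}) e (a : 'M[int]_(n, e)) (h : 'M[k]_n) :
  (forall x, f (i x) = iK x) -> h \in unitmx ->
  torus_of (map_mx f h) a `<=` G ->
  exists2 hK : 'M[K]_n, hK \in unitmx & torus_of (map_mx iK hK) a `<=` G.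
Proof.
move=> fi uh hG; have [|hK uhK hKE] := @transfer_tor K k i n e a (fun=> E) h uh.
  by move=> y p y0 Ep; apply: (vanish_on_torus fi) => //; apply: nonvanishing_map.
by exists hK => //; apply: torus_of_rational_sub.
Qed.

(** Let [T] be a [k]-split torus of the group that contains [S].  The inclusion is
    given by an integer matrix [M], and the conditions on [h] that the torus with
    the same weights lies in the group and contains [S] through [M] transfer to [K].
    The resulting torus is [S] by maximality, so [M] is surjective on points and
    [S] is all of [T]. *)
Lemma maximal_split_torus_extends (k : rcfType) (i : {rmorphism K -> k})
    (f : {rmorphism k -> D}) (S : set 'M[D]_n) : (forall x, f (i x) = iK x) ->
  maximal_split_torus iK G S -> maximal_split_torus f G S.
Proof.
move=> fi [S_split S_G S_max].
have mapf m r (A : 'M[K]_(m, r)) : map_mx f (map_mx i A) = map_mx iK A.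
  by apply/matrixP => l l'; rewrite !mxE fi.
have [d [h0 [b [c0 [uh0 c0b SE]]]]] := split_torusP S_split.
have uih0 : map_mx i h0 \in unitmx by rewrite map_unitmx.
have SE' : S = torus_of (map_mx f (map_mx i h0)) b by rewrite mapf.
split=> //; first by rewrite SE'; apply: split_torus_of c0b.
move=> T T_split T_G ST.
have [e [h [a [c [uh ca TE]]]]] := split_torusP T_split.
have sub0 : torus_of (map_mx f (map_mx i h0)) b `<=` torus_of (map_mx f h) a.
  by rewrite -SE' -TE.
have [M [N [NM ME]]] := torus_of_sub uih0 uh c0b ca sub0.
(* The second family of equations expresses that [S] is contained through [M]:
   it is imposed at the points of [S] with coordinates in [K]. *)
have [hK uhK hKJ] : exists2 hK : 'M[K]_n, hK \in unitmx &
    forall y p, nonvanishing y -> E p \/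
      (exists2 x, nonvanishing x & y = mons M x /\ exists l l',
        p = 'X_(lshift 1 (mxvec_index l l')) - (tor h0 b x l l')%:MP) ->
    p.@[coords (tor hK a y) (\det (tor hK a y))^-1] = 0.
  apply: (@transfer_tor K k i n e a _ h uh) => y p y0 [Ep|[x x0 [-> [l [l' ->]]]]].
    apply: (vanish_on_torus fi) => //; first by rewrite -TE.
    exact: nonvanishing_map.
  rewrite !raddfB /= map_mpolyX map_mpolyC mevalXU mevalC /coords row_mxEl mxvecE.
  have -> : tor h a (map_mx i (mons M x)) = map_mx i (tor h0 b x).
    apply: (map_mx_inj (f := f)).
    rewrite map_tor !mapf -map_mons -ME; last exact: nonvanishing_map.
    by rewrite mapf -map_tor.
  by rewrite mxE subrr.
have TK_split : split_torus iK (torus_of (map_mx iK hK) a).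
  exact: split_torus_of ca.
have TK_G : torus_of (map_mx iK hK) a `<=` G.
  apply: (torus_of_rational_sub uhK) => y p y0 Ep.
  by apply: hKJ => //; left.
have ME_K x : nonvanishing x ->
    tor (map_mx iK h0) b x = tor (map_mx iK hK) a (mons M x).
  move=> x0; apply/matrixP => l l'.
  rewrite -[in LHS](mons1 x).
  apply: tor_entries_dense x x0 => x x0; rewrite mons1.
  apply/esym/eqP; rewrite -subr_eq0; apply/eqP.
  have : ('X_(lshift 1 (mxvec_index l l')) - (tor h0 b x l l')%:MP).@[
      coords (tor hK a (mons M x)) (\det (tor hK a (mons M x)))^-1] = 0.
    apply: hKJ; first exact: nonvanishing_mons.
    by right; exists x => //; split=> //; exists l, l'.
  by rewrite raddfB /= mevalXU mevalC /coords row_mxEl mxvecE.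
have TKS : torus_of (map_mx iK hK) a = S.
  apply: S_max => //; rewrite SE => _ [x x0 <-].
  by exists (mons M x); [apply: nonvanishing_mons | rewrite ME_K].
apply/seteqP; split=> //; rewrite TE => _ [y y0 <-].
have : S (tor (map_mx iK hK) a y) by rewrite -TKS; exists y.
rewrite SE => -[x x0]; rewrite ME_K // => /tor_inj yE.
have <- : mons M x = y.
  by apply: (yE c) => //; [rewrite map_unitmx | apply: nonvanishing_mons].
by rewrite -ME //; exists x; rewrite // mapf.
Qed.

(** Up to the real numbers, where a symmetric torus with the same weights exists, and
    back to [K] by transfer of the equations that express symmetry. *)
Lemma symmetric_torus_descends (R : realType) (j : {rmorphism K -> R})
    (f : {rmorphism R -> D}) e (a : 'M[int]_(n, e)) (h : 'M[K]_n) :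
  (forall x, f (j x) = iK x) -> linear_algebraic_group G -> self_adjoint G ->
  h \in unitmx -> torus_of (map_mx iK h) a `<=` G ->
  exists h' : 'M[K]_n, [/\ h' \in unitmx, torus_of (map_mx iK h') a `<=` G &
    forall g, torus_of (map_mx iK h') a g -> g^T = g].
Proof.
move=> fj [_ G1 GM GV] G_adj uh hG.
have EG g := gl_zeros_group g fj.
have [||||||hR uhR hRE] := @symmetric_torus R n e [set map_mpoly j p | p in E] a (map_mx j h).
- by apply/EG; rewrite map_mx1.
- by move=> g g' /EG Gg /EG Gg'; apply/EG; rewrite map_mxM; apply: GM.
- by move=> g /EG Gg; apply/EG; rewrite map_invmx; apply: GV.
- by move=> g /EG Gg; apply/EG; rewrite -map_trmx; apply: G_adj.
- by rewrite map_unitmx.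
- move=> y y0; apply/EG; rewrite map_tor -map_mx_comp (eq_map_mx _ fj).
  by apply: hG; exists (map_mx f y) => //; apply: nonvanishing_map.
have [h1 uh1 h1J] : exists2 h1 : 'M[K]_n, h1 \in unitmx &
    forall y p, nonvanishing y -> E p \/ (exists l l',
      p = 'X_(lshift 1 (mxvec_index l l')) - 'X_(lshift 1 (mxvec_index l' l))) ->
    p.@[coords (tor h1 a y) (\det (tor h1 a y))^-1] = 0.
  apply: (@transfer_tor K R j n e a _ hR uhR) => y p y0 [Ep|[l [l' ->]]].
    have [[_ H] _] := hRE _ (nonvanishing_map j y0).
    by apply: H; exists p.
  rewrite !raddfB /= !map_mpolyX !mevalXU /coords !row_mxEl !mxvecE.
  have [_ sym] := hRE _ (nonvanishing_map j y0).
  by rewrite -[in X in X - _]sym mxE subrr.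
exists h1; split=> //.
  by apply: (torus_of_rational_sub uh1) => y p y0 Ep; apply: h1J => //; left.
move=> _ [y y0 <-]; apply/matrixP => l l'; rewrite mxE -(mons1 y).
apply: tor_entries_dense y y0 => y y0; rewrite mons1.
apply/eqP; rewrite -subr_eq0; apply/eqP.
have := h1J y _ y0 (or_intror (ex_intro _ l' (ex_intro _ l erefl))).
by rewrite raddfB /= !mevalXU /coords !row_mxEl !mxvecE.
Qed.

(** An inclusion of split tori increases the dimension, unless it is an equality. *)
Lemma maximal_split_torus_of_dim (k : rcfType) (f : {rmorphism k -> D}) e
    (a : 'M[int]_(n, e)) (c : 'M[int]_(e, n)) (h : 'M[k]_n) :
  h \in unitmx -> c *m a = 1%:M -> torus_of (map_mx f h) a `<=` G ->
  (forall e' (a' : 'M[int]_(n, e')) (c' : 'M[int]_(e', n)) (h' : 'M[k]_n),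
     h' \in unitmx -> c' *m a' = 1%:M -> torus_of (map_mx f h') a' `<=` G ->
     (e' <= e)%N) ->
  maximal_split_torus f G (torus_of (map_mx f h) a).
Proof.
move=> uh ca hG e_max; split=> //; first exact: split_torus_of ca.
move=> T T_split T_G ST.
have [e' [h' [a' [c' [uh' ca' TE]]]]] := split_torusP T_split.
rewrite TE in T_G ST *.
have [M [N [NM _]]] := torus_of_sub uh uh' ca ca' ST.
have ee : e' = e by apply/eqP; rewrite eqn_leq (e_max _ a' c' h') // (left_inverse_leq NM).
by subst e'; apply: torus_of_eq ca ca' ST.
Qed.

End GroupPoints.

Theorem theorem4p17 (D : closedFieldType) (R : realType) (F K : rcfType)
    (iR : {rmorphism R -> D}) (iF : {rmorphism F -> D})
    (iK : {rmorphism K -> D})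
    (K_sub_RF : range iK `<=` range iR `&` range iF)
    (n : nat) (G : set 'M[D]_n)
    (G_group : linear_algebraic_group G)
    (G_semisimple : semisimple G)
    (G_self_adjoint : self_adjoint G)
    (G_over_K : defined_over iK G) :
  (forall S : set 'M[D]_n,
     maximal_split_torus iK G S -> maximal_split_torus iF G S) /\
  (exists S : set 'M[D]_n,
     maximal_split_torus iF G S /\ forall g, S g -> g^T = g).
Proof.
have [i iE] : exists i : {rmorphism K -> F}, forall x, iF (i x) = iK x.
  by apply: factor_embedding => x /K_sub_RF[].
have [j jE] : exists j : {rmorphism K -> R}, forall x, iR (j x) = iK x.
  by apply: factor_embedding => x /K_sub_RF[].
have [E GE] := G_over_K.
split=> [S|]; first exact: (maximal_split_torus_extends GE iE).
(* [has e]: the group contains an [F]-split torus of dimension [e]. *)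
pose has e := exists (a : 'M[int]_(n, e)) (c : 'M[int]_(e, n)) (h : 'M[F]_n),
  [/\ c *m a = 1%:M, h \in unitmx & torus_of (map_mx iF h) a `<=` G].
have has0 : has 0%N.
  exists 0, 0, 1%:M; split; [by apply/matrixP => -[] | exact: unitmx1 |].
  move=> _ [y y0 <-]; have -> : y = const_mx 1 by apply/rowP => -[].
  by rewrite tor1 ?map_unitmx ?unitmx1 //; case: G_group.
have has_le e : `[< has e >] -> (e <= n)%N.
  by move=> /asboolP[a [c [h [ca _ _]]]]; apply: left_inverse_leq ca.
have exP : exists e, `[< has e >] by exists 0%N; apply/asboolP.
case: (ex_maxnP exP has_le) => e /asboolP[a [c [h [ca uh hG]]]] e_max.
have [hK uhK hK_G] := torus_descends GE iE uh hG.
have [h1 [uh1 h1_G h1_sym]] :=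
  symmetric_torus_descends GE jE G_group G_self_adjoint uhK hK_G.
have SE : map_mx iF (map_mx i h1) = map_mx iK h1.
  by rewrite -map_mx_comp (eq_map_mx _ iE).
exists (torus_of (map_mx iK h1) a); split=> //; rewrite -SE.
apply: (maximal_split_torus_of_dim (c := c)); rewrite ?map_unitmx ?SE //.
move=> e' a' c' h' uh' ca' h'_G.
by apply: e_max; apply/asboolP; exists a', c', h'.
Qed.
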